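(* For all integers $n\ge1$, $k\ge2$, every pattern $A$ and every pathset $\mathcal{A}\in\mathcal{P}_{A}$, $$\bar\chi_A(\mathcal{A})\ \ge\ \tilde n^{(1/6)\log(\ell(A))+c(A)}\cdot\delta(\mathcal{A}).$$
   Context: Logarithms are base 2 (with $\log 0=-\infty$, $\tilde n^{-\infty}=0$). $P_k$ has vertex set $V_k=\{v_0,\dots,v_k\}$ and edges $E_k=\{v_iv_{i+1}:0\le i<k\}$. A pattern graph is $G=(V_G,E_G)$ with $E_G\subseteq E_k$ and $V_G$ the set of endpoints of $E_G$; $c(G)$ is its number of components and $\ell(G)$ the number of edges of its largest component. For a finite set $V$, $[n]^V$ is the set of maps $V\to[n]$; $x_S$ denotes restriction; $xy$ the common extension of tuples on disjoint sets. For $\mathcal{A}\subseteq[n]^V$: $\delta(\mathcal{A})=|\mathcal{A}|/n^{|V|}$; for $S\subseteq V$, $z\in[n]^{V\setminus S}$, $\mathcal{A}|^z_S=\{y\in[n]^S:yz\in\mathcal{A}\}$ and $\mu_S(\mathcal{A})=\max_z|\mathcal{A}|^z_S|/n^{|S|}$. Join: $\mathcal{A}\bowtie\mathcal{B}=\{x\in[n]^{V\cup W}:x_V\in\mathcal{A},x_W\in\mathcal{B}\}$ for $\mathcal{A}\subseteq[n]^V,\mathcal{B}\subseteq[n]^W$. $\mathcal{P}_G$ is the power set of $[n]^{V_G}$. $\varepsilon=1/\log k$, $\tilde n=n^{1-\varepsilon}$. $\mathcal{A}\in\mathcal{P}_G$ is $G$-small if $\mu_S(\mathcal{A})\le\tilde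 n^{-t}$ for every $1\le t\le c(G)$ and every $S\subseteq V_G$ that is a union of $t$ components of $G$; $\mathcal{P}^{\mathrm{small}}_G$ denotes the $G$-small pathsets. A pattern is either the empty pattern $\emptyset$ or a rooted unordered binary tree (every internal node has two children) whose leaves are labeled by elements of $E_k$ (labels may repeat). Its pattern graph $G_A=(V_A,E_A)$ has $E_A$ = set of leaf labels. A pattern with one leaf is atomic; a non-atomic pattern whose root has subtrees $B,C$ is written $\{B,C\}$. We write $\mathcal{P}_A=\mathcal{P}_{G_A}$, $c(A)=c(G_A)$, $\ell(A)=\ell(G_A)$. Pathset complexity w.r.t. patterns: $\bar\chi_\emptyset(\mathcal{A})=0$; for atomic $A$, $\bar\chi_A(\mathcal{A})=|\mathcal{A}|$; for $A=\{B,C\}$, $\bar\chi_A(\mathcal{A})=\min\sum_i\big(\bar\chi_B(\mathcal{B}_i)+\bar\chi_C(\mathcal{C}_i)\big)$ over finite sequences with $\mathcal{B}_i\in\mathcal{P}^{\mathrm{small}}_{G_B}$, $\mathcal{C}_i\in\mathcal{P}^{\mathrm{small}}_{G_C}$ and $\mathcal{A}\subseteq\bigcup_i\mathcal{B}_i\bowtie\mathcal{C}_i$. *)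

(* Defs.v *)
From HB Require Import structures.
From mathcomp Require Import all_boot all_order all_algebra.
From mathcomp Require Import boolp reals constructive_ereal exp.
Set Implicit Arguments.
Unset Strict Implicit.
Unset Printing Implicit Defensive.
Import Order.TTheory GRing.Theory Num.Theory.
Local Open Scope ring_scope.

Section Logarithms.
Variable R : realType.

(* [lne] sends 0 to -oo, so [log2 0 = -oo]. *)
Definition log2 (x : R) : \bar R := (lne x%:E * ((ln 2)^-1)%:E)%E.

(* The convention [a ^ -oo = 0] is only meant for [a >= 1]; the value at +oo
   is never used, since [log2] of a real number is never +oo. *)
Definition powRe (a : R) (e : \bar R) : R :=
  match e with
  | r%:E => a `^ r
  | -oo%E => 0
  | +oo%E => 0
  end.

Definition epsilon (k : nat) : R := (fine (log2 k%:R))^-1.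

Definition ntilde (n k : nat) : R := n%:R `^ (1 - epsilon k).

End Logarithms.

Section PatternGraphs.
Variable k : nat.

(* The vertex v_i of P_k is i : 'I_k.+1, and the edge v_i v_{i+1} is i : 'I_k;
   a pattern graph is given by its edge set. *)
Definition src (e : 'I_k) : 'I_k.+1 := widen_ord (leqnSn k) e.
Definition dst (e : 'I_k) : 'I_k.+1 := lift ord0 e.

Definition vertices (E : {set 'I_k}) : {set 'I_k.+1} :=
  [set v | [exists e in E, (v == src e) || (v == dst e)]].

Definition adj (E : {set 'I_k}) : rel 'I_k.+1 := fun u v =>
  [exists e in E, ((u == src e) && (v == dst e)) ||
                  ((u == dst e) && (v == src e))].

Definition components (E : {set 'I_k}) : {set {set 'I_k.+1}} :=
  equivalence_partition (connect (adj E)) (vertices E).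

Definition ncomp (E : {set 'I_k}) : nat := #|components E|.

Definition edges_in (E : {set 'I_k}) (K : {set 'I_k.+1}) : {set 'I_k} :=
  [set e in E | (src e \in K) && (dst e \in K)].

Definition maxlen (E : {set 'I_k}) : nat :=
  (\max_(K in components E) #|edges_in E K|)%N.

Definition union_of_components (E : {set 'I_k}) (t : nat) (S : {set 'I_k.+1})
  : Prop :=
  exists2 T : {set {set 'I_k.+1}},
    (T \subset components E) && (#|T| == t) & S = cover T.

End PatternGraphs.

Section Pathsets.
Variables k n : nat.

(* Maps from a subset V of V_k to [n], for all V at once: partial functions on
   V_k, equal to [None] exactly outside V. *)
Definition ptuple : finType := {ffun 'I_k.+1 -> option 'I_n}.

Definition tuples (V : {set 'I_k.+1}) : {set ptuple} :=
  [set x : ptuple | [forall i, (x i != None) == (i \in V)]].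

Definition restr (S : {set 'I_k.+1}) (x : ptuple) : ptuple :=
  [ffun i => if i \in S then x i else None].

Definition glue (x y : ptuple) : ptuple :=
  [ffun i => if x i is Some a then Some a else y i].

Definition pathsets (V : {set 'I_k.+1}) : {set {set ptuple}} :=
  powerset (tuples V).

Definition section (S : {set 'I_k.+1}) (A : {set ptuple}) (z : ptuple)
  : {set ptuple} := [set y in tuples S | glue y z \in A].

Definition join (V W : {set 'I_k.+1}) (A B : {set ptuple}) : {set ptuple} :=
  [set x in tuples (V :|: W) | (restr V x \in A) && (restr W x \in B)].

Variable R : realType.

Definition density (V : {set 'I_k.+1}) (A : {set ptuple}) : R :=
  #|A|%:R / n%:R ^+ #|V|.

Definition mu (V S : {set 'I_k.+1}) (A : {set ptuple}) : R :=
  (\max_(z in tuples (V :\: S)) #|section S A z|)%N%:R / n%:R ^+ #|S|.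

Definition small (E : {set 'I_k}) (A : {set ptuple}) : Prop :=
  A \in pathsets (vertices E) /\
  forall (t : nat) (S : {set 'I_k.+1}),
    (1 <= t <= ncomp E)%N -> union_of_components E t S ->
    mu (vertices E) S A <= ntilde R n k ^- t.

End Pathsets.

(* Nonempty patterns, with the two children of a node listed in some order;
   [chi_nodeC] below shows that the order is irrelevant. *)
Inductive tree (k : nat) : Type :=
| Leaf of 'I_k
| Node of tree k & tree k.

Definition pattern (k : nat) : Type := option (tree k).

Fixpoint tree_edges (k : nat) (A : tree k) : {set 'I_k} :=
  match A with
  | Leaf e => [set e]
  | Node B C => tree_edges B :|: tree_edges C
  end.

Definition pattern_edges (k : nat) (A : pattern k) : {set 'I_k} :=
  if A is Some A' then tree_edges A' else set0.

(* The minimum of a nonempty set of natural numbers (0 if it is empty). *)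
Definition nat_min (P : nat -> Prop) : nat :=
  if pselect (exists m, [pred m | `[< P m >]] m) is left h
  then ex_minn h else 0%N.

Definition covering (R : realType) (k n : nat) (EB EC : {set 'I_k})
    (A : {set ptuple k n}) (s : seq ({set ptuple k n} * {set ptuple k n}))
  : Prop :=
  (forall p, p \in s -> small R EB p.1 /\ small R EC p.2) /\
  A \subset (\bigcup_(p <- s) join (vertices EB) (vertices EC) p.1 p.2)%SET.

(* By [chi_node_min] below, the minimum is over a nonempty set. *)
Fixpoint tree_chi (R : realType) (k n : nat) (T : tree k)
    (A : {set ptuple k n}) : nat :=
  match T with
  | Leaf _ => #|A|
  | Node B C =>
      nat_min (fun m => exists2 s,
        covering R (tree_edges B) (tree_edges C) A s &
        m = (\sum_(p <- s) (tree_chi R B p.1 + tree_chi R C p.2))%N)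
  end.

Definition chi (R : realType) (k n : nat) (T : pattern k)
    (A : {set ptuple k n}) : nat :=
  if T is Some T' then tree_chi R T' A else 0%N.

Lemma nat_minP (P : nat -> Prop) : (exists m, P m) ->
  P (nat_min P) /\ forall m, P m -> (nat_min P <= m)%N.
Proof.
move=> [m Pm]; rewrite /nat_min; case: pselect => [h|[]]; last first.
  by exists m; apply/asboolP.
case: ex_minnP => j /= /asboolP Pj jmin; split=> // i Pi.
by apply: jmin; apply/asboolP.
Qed.

Lemma joinC (k n : nat) (V W : {set 'I_k.+1}) (A B : {set ptuple k n}) :
  join V W A B = join W V B A.
Proof. by apply/setP => x; rewrite !inE finset.setUC andbA andbAC -andbA. Qed.

Lemma chi_nodeC (R : realType) (k n : nat) (B C : tree k)
    (A : {set ptuple k n}) :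
  tree_chi R (Node B C) A = tree_chi R (Node C B) A.
Proof.
rewrite /=; congr nat_min; apply/funext => m; apply/propext.
have aux (D F : tree k) :
    (exists2 s, covering R (tree_edges D) (tree_edges F) A s &
      m = (\sum_(p <- s) (tree_chi R D p.1 + tree_chi R F p.2))%N) ->
    (exists2 s, covering R (tree_edges F) (tree_edges D) A s &
      m = (\sum_(p <- s) (tree_chi R F p.1 + tree_chi R D p.2))%N).
  move=> [s [sm cov] ->]; exists [seq (p.2, p.1) | p <- s].
    split; first by move=> _ /mapP[p ps ->] /=; case: (sm p ps).
    rewrite big_map /=; under eq_bigr do rewrite joinC; exact: cov.
  by rewrite big_map; apply: eq_bigr => p _; rewrite addnC.
by split; apply: aux.
Qed.

Lemma components_partition (k : nat) (E : {set 'I_k}) :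
  finset.partition (components E) (vertices E).
Proof.
apply: equivalence_partitionP => x y z _ _ _.
have sym : connect_sym (adj E).
  apply: fingraph.sym_connect_sym => u v.
  by apply: eq_existsb => e /=; rewrite orbC ![(v == _) && _]andbC.
split; first exact: connect0.
by move=> xy; apply: same_connect.
Qed.

Lemma ntilde_gt0 (R : realType) (n k : nat) : (1 <= n)%N ->
  0 < ntilde R n k.
Proof. by move=> n1; rewrite powR_gt0 // ltr0n. Qed.

Lemma ntilde_le (R : realType) (n k : nat) : (1 <= n)%N -> (2 <= k)%N ->
  ntilde R n k <= n%:R.
Proof.
move=> n1 k2; rewrite -[leRHS]powRr1 ?ler0n // ler_powR ?ler1n //.
rewrite gerBl /epsilon invr_ge0 /log2 lne_EFin ?ltr0n ?(leq_trans _ k2) //.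
by rewrite -EFinM /= mulr_ge0 ?invr_ge0 ?ln_ge0 ?ler1n ?(leq_trans _ k2).
Qed.

Lemma small_set1 (R : realType) (k n : nat) (E : {set 'I_k}) (x : ptuple k n) :
  (1 <= n)%N -> (2 <= k)%N -> x \in tuples n (vertices E) ->
  small R E [set x].
Proof.
move=> n1 k2 xE; split; first by rewrite powersetE sub1set.
move=> t _ _ [T /andP[TE /eqP <-] ->].
have [_ trE n0] := and3P (components_partition E).
have tT : (#|T| <= #|cover T|)%N.
  have -> : #|cover T| = (\sum_(K in T) #|K|)%N.
    by apply/esym/eqP; apply: (trivIsetS TE).
  rewrite -sum1_card; apply: leq_sum => K KT; rewrite card_gt0.
  by apply: contra n0 => /eqP <-; apply: (subsetP TE).
have n0R : 0 < n%:R :> R by rewrite ltr0n.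
apply: (@le_trans _ _ (n%:R ^- #|cover T|)).
  rewrite /mu ler_piMl ?invr_ge0 ?exprn_ge0 ?ler0n // -[leRHS]/(1%:R) ler_nat.
  apply/bigmax_leqP => z _; rewrite -(cards1 (restr (cover T) x)).
  apply/subset_leq_card/subsetP => y; rewrite !inE => /andP[/forallP yT].
  move=> /eqP <-; apply/eqP/ffunP => i; rewrite !ffunE -(eqP (yT i)).
  by case: (y i).
apply: (@le_trans _ _ (n%:R ^- #|T|)).
  by rewrite lef_pV2 ?posrE ?exprn_gt0 // ler_weXn2l ?ler1n.
rewrite lef_pV2 ?posrE ?exprn_gt0 ?ntilde_gt0 //.
by rewrite lerXn2r ?nnegrE ?ntilde_le // ltW ?ntilde_gt0.
Qed.

Lemma restr_tuples (k n : nat) (V W : {set 'I_k.+1}) (x : ptuple k n) :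
  V \subset W -> x \in tuples n W -> restr V x \in tuples n V.
Proof.
move=> /subsetP VW; rewrite !inE => /forallP xW; apply/forallP => i.
rewrite ffunE; case: ifP => [/VW iW|//].
by rewrite (eqP (xW i)) iW.
Qed.

Lemma verticesU (k : nat) (E F : {set 'I_k}) :
  vertices (E :|: F) = vertices E :|: vertices F.
Proof.
apply/setP => v; rewrite !inE; apply/existsP/orP => [[e]|].
  rewrite inE => /andP[/orP[] eE ev]; [left|right];
  by apply/existsP; exists e; rewrite eE.
by case=> /existsP[e /andP[eE ev]]; exists e; rewrite inE eE ?orbT.
Qed.

Lemma covering_exists (R : realType) (k n : nat) (E F : {set 'I_k})
    (A : {set ptuple k n}) : (1 <= n)%N -> (2 <= k)%N ->
  A \in pathsets n (vertices (E :|: F)) -> exists s, covering R E F A s.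
Proof.
move=> n1 k2; rewrite powersetE verticesU => /subsetP AV.
exists [seq ([set restr (vertices E) x], [set restr (vertices F) x])
       | x <- enum A]; split.
  move=> p /mapP[x]; rewrite mem_enum => /AV xV -> /=.
  by split; apply: small_set1 => //; apply: restr_tuples xV;
    rewrite ?finset.subsetUl ?finset.subsetUr.
apply/subsetP => x xA; rewrite big_map big_enum /=.
apply/bigcupP; exists x => //.
by rewrite finset.in_set (AV x xA) !finset.set11.
Qed.

Lemma chi_node_min (R : realType) (k n : nat) (B C : tree k)
    (A : {set ptuple k n}) :
  let E := tree_edges B in let F := tree_edges C in
  let cost s := (\sum_(p <- s) (tree_chi R B p.1 + tree_chi R C p.2))%N in
  (1 <= n)%N -> (2 <= k)%N -> A \in pathsets n (vertices (E :|: F)) ->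
  (exists2 s, covering R E F A s & tree_chi R (Node B C) A = cost s) /\
  (forall s, covering R E F A s -> (tree_chi R (Node B C) A <= cost s)%N).
Proof.
move=> E F cost n1 k2 AV.
have [s cs] := covering_exists R n1 k2 AV.
have [] := @nat_minP (fun m => exists2 s, covering R E F A s & m = cost s).
  by exists (cost s), s.
by move=> ex lb; split=> [//|s' cs']; apply: lb; exists s'.
Qed.

(* Main.v *)
(* The exponent of a pattern A is measured by the excess Phi(A) of the bound
   chi_A(X) >= ntilde^(Phi(A) + c(A)) * density(X), and Phi(A) >= log(l(A)) / 6 is
   shown by induction on the size of A.  Let K be a component of G_A with
   l = l(A) edges.

   Unfolding the coverings along the branch from A to a subpattern D bounds the
   density of X by the densities of joins of pathsets of D with small pathsets of
   the siblings, and each component of a sibling that is away from what has been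
   joined so far contributes a factor 1/ntilde.  Hence Phi(A) >= Phi(D) + m + q - 1
   if D has m components in K and some sibling has q components in K away from D.
   If A = {B,C}, D lies below B and E below C, and both have components in K, those
   of E being away from D, then the same estimate bounds the density of a join by
   the product of the costs of both sides, and the AM-GM inequality gives
   Phi(A) >= (Phi(D) + Phi(E') + 1) / 2, with E' the restriction of E to the
   components away from D.

   If Phi(A) < log(l) / 6, then by the first bound and induction every subpattern
   with at least l/32 edges in K meets K in an interval that is touched by every
   component in K of every sibling on its branch.  Following minimal subpatterns
   that contain a given interval, one finds a subpattern with at least l/8 edges
   inside the left half of K, and by symmetry another one inside the right half.
   At their lowest common ancestor the second bound gives
   (log(l/8) / 6 + log(l/8) / 6 + 1) / 2 = log(l) / 6. *)
Require Import Defs.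
From mathcomp Require Import all_boot all_order all_algebra.
From mathcomp Require Import boolp reals constructive_ereal exp.
From mathcomp Require Import zify ring lra.
Set Implicit Arguments.
Unset Strict Implicit.
Unset Printing Implicit Defensive.
Import Order.TTheory GRing.Theory Num.Theory.
Local Open Scope ring_scope.

(** * Components of subgraphs of a path *)

Section Graphs.
Variable k : nat.
Implicit Types (E F G : {set 'I_k}) (u v : 'I_k.+1) (P Q : {set 'I_k.+1}).
Implicit Types (S : {set 'I_k.+1}) (QQ : {set {set 'I_k.+1}}).

Lemma adj_connect_sym E : connect_sym (adj E).
Proof.
apply: fingraph.sym_connect_sym => u v.
by apply: eq_existsb => e /=; rewrite orbC ![(v == _) && _]andbC.
Qed.

Lemma verticesP E v :
  reflect (exists2 e, e \in E & (v == src e) || (v == dst e)) (v \in vertices E).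
Proof.
rewrite inE; apply: (iffP existsP) => [[e /andP[eE ev]]|[e eE ev]]; exists e => //.
by rewrite eE.
Qed.

Lemma src_vertices E (e : 'I_k) : e \in E -> src e \in vertices E.
Proof. by move=> eE; apply/verticesP; exists e; rewrite ?eqxx. Qed.

Lemma dst_vertices E (e : 'I_k) : e \in E -> dst e \in vertices E.
Proof. by move=> eE; apply/verticesP; exists e; rewrite ?eqxx ?orbT. Qed.

Lemma adj_edge E (e : 'I_k) : e \in E -> adj E (src e) (dst e).
Proof. by move=> eE; apply/existsP; exists e; rewrite eE !eqxx. Qed.

Lemma adjP E u v : reflect
  (exists2 e, e \in E & (u = src e /\ v = dst e) \/ (u = dst e /\ v = src e))
  (adj E u v).
Proof.
apply: (iffP existsP) => [[e /andP[eE /orP[]/andP[/eqP-> /eqP->]]]|].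
- by exists e => //; left.
- by exists e => //; right.
by move=> [e eE [] [-> ->]]; exists e; rewrite eE !eqxx ?orbT.
Qed.

Lemma connectS E F : E \subset F -> subrel (connect (adj E)) (connect (adj F)).
Proof.
move=> /subsetP EF; apply: connect_sub => u v /adjP[e eE uv].
by apply: connect1; apply/adjP; exists e => //; apply: EF.
Qed.

Lemma verticesS E F : E \subset F -> vertices E \subset vertices F.
Proof.
move=> /subsetP EF; apply/subsetP => v /verticesP[e /EF eF ev].
by apply/verticesP; exists e.
Qed.

Definition block E v := [set u in vertices E | connect (adj E) v u].

Lemma componentsP E P :
  reflect (exists2 v, v \in vertices E & P = block E v) (P \in components E).
Proof. exact: imsetP. Qed.

Lemma in_block E v x :
  (x \in block E v) = (x \in vertices E) && connect (adj E) v x.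
Proof. by rewrite {1}/block in_set. Qed.

Lemma mem_block E v : v \in vertices E -> v \in block E v.
Proof. by move=> vE; rewrite in_block vE connect0. Qed.

Lemma block_components E v : v \in vertices E -> block E v \in components E.
Proof. by move=> vE; apply/componentsP; exists v. Qed.

Lemma components_block E P v : P \in components E -> v \in P -> P = block E v.
Proof.
move=> /componentsP[w wE ->]; rewrite in_block => /andP[vE wv].
apply/setP => x; rewrite !in_block; congr (_ && _).
by apply: same_connect => //; apply: adj_connect_sym.
Qed.

Lemma components_sub_vertices E P : P \in components E -> P \subset vertices E.
Proof. by move=> /componentsP[w _ ->]; apply/subsetP => x; rewrite in_block => /andP[]. Qed.

Lemma components_nonempty E P : P \in components E -> exists v, v \in P.
Proof. by move=> /componentsP[w wE ->]; exists w; apply: mem_block. Qed.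

Lemma components_refine F G P Q v : F \subset G ->
  P \in components F -> Q \in components G -> v \in P -> v \in Q -> P \subset Q.
Proof.
move=> FG PF QG vP vQ; rewrite (components_block PF vP) (components_block QG vQ).
apply/subsetP => x; rewrite !in_block => /andP[xF vx].
by rewrite (subsetP (verticesS FG)) //= (connectS FG).
Qed.

Lemma components_eq E P Q v : P \in components E -> Q \in components E ->
  v \in P -> v \in Q -> P = Q.
Proof. by move=> PE QE vP vQ; rewrite (components_block PE vP) (components_block QE vQ). Qed.

(* Removing the edge [f] from P_k separates the vertices up to [f] from the rest. *)
Lemma connect_crosses E u v (f : 'I_k) :
  connect (adj E) u v -> (u <= f < v)%N -> f \in E.
Proof.
move=> uv /andP[uf fv]; apply: contraT => fE.
have cl : closed (adj E) [pred x : 'I_k.+1 | (x <= f)%N].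
  move=> x y /adjP[e eE]; rewrite !inE.
  have : e != f by apply: contraNneq fE => <-.
  rewrite -(inj_eq val_inj) /= => ef.
  by case=> -[-> ->]; rewrite /= /bump /=; apply/idP/idP; lia.
by have := closed_connect cl uv; rewrite !inE uf; lia.
Qed.

Definition away F E : {set {set 'I_k.+1}} :=
  [set P in components F | [disjoint P & vertices E]].

Definition hits QQ E : {set {set 'I_k.+1}} :=
  [set Q in QQ | ~~ [disjoint Q & vertices E]].

(* [QQ] will consist of the components of a larger graph other than some given
   ones, so that [outer] selects the components of [F] inside the given ones. *)
Definition outer QQ F E : {set {set 'I_k.+1}} :=
  [set P in away F E | [forall Q in QQ, ~~ (P \subset Q)]].

Lemma in_away F E P :
  (P \in away F E) = (P \in components F) && [disjoint P & vertices E].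
Proof. by rewrite in_set. Qed.

Lemma in_hits QQ E Q :
  (Q \in hits QQ E) = (Q \in QQ) && ~~ [disjoint Q & vertices E].
Proof. by rewrite in_set. Qed.

Lemma in_outer QQ F E P : (P \in outer QQ F E) =
  (P \in away F E) && [forall Q in QQ, ~~ (P \subset Q)].
Proof. by rewrite in_set. Qed.

Lemma vertices0 : vertices (set0 : {set 'I_k}) = set0.
Proof.
apply/setP => v; rewrite [RHS]inE; by apply/negP => /verticesP[e]; rewrite inE.
Qed.

Lemma away0 F : away F set0 = components F.
Proof.
by apply/setP => P; rewrite in_away vertices0 -setI_eq0 setI0 eqxx andbT.
Qed.

Lemma hits0 QQ : hits QQ set0 = set0.
Proof.
by apply/setP => P; rewrite in_hits vertices0 -setI_eq0 setI0 eqxx andbF inE.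
Qed.

Lemma hits_full E QQ : QQ \subset components E -> hits QQ E = QQ.
Proof.
move=> /subsetP QE; apply/setP => Q; rewrite in_hits andb_idr // => /QE QE'.
have [v vQ] := components_nonempty QE'.
apply/pred0Pn; exists v; rewrite /= vQ /=.
exact: (subsetP (components_sub_vertices QE')).
Qed.

(* A member of [QQ] hit by [F] but not by [E] contains a component of [F] away
   from [E]. *)
Lemma card_outer_hits E F G QQ : F \subset G -> QQ \subset components G ->
  (#|outer QQ F E| + #|hits QQ (E :|: F)| <= #|away F E| + #|hits QQ E|)%N.
Proof.
move=> FG /subsetP QG.
(* [g] sends a component in [inner] to the member of [QQ] containing it. Its image covers every
   member that [F] hits and [E] does not. *)
pose inner := away F E :\: outer QQ F E.
pose g P := odflt set0 [pick Q in QQ | P \subset Q].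
have sub : hits QQ (E :|: F) \subset hits QQ E :|: [set g P | P in inner].
  apply/subsetP => Q; rewrite in_setU !in_hits => /andP[QQQ].
  rewrite verticesU => hit; rewrite QQQ /=; case: (boolP [disjoint Q & vertices E]) => //= QE.
  have /pred0Pn[v /andP[/= vQ]] := hit.
  rewrite in_setU; case: (boolP (v \in vertices E)) => /= [vE _|_ vF].
    by have /pred0P/(_ v) /= := QE; rewrite vQ vE.
  apply/imsetP; exists (block F v).
    have bQ : block F v \subset Q.
      by apply: (components_refine FG (block_components vF) (QG _ QQQ) (mem_block vF) vQ).
    rewrite in_setD in_outer !in_away block_components //= (disjointWl bQ QE) /= andbT.
    by rewrite negb_forall; apply/existsP; exists Q; rewrite QQQ bQ.
  rewrite /g; case: pickP => [Q' /andP[Q'Q vQ']|/(_ Q)] /=.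
    apply: (@components_eq G _ _ v (QG _ QQQ) (QG _ Q'Q)) => //.
    by apply: (subsetP vQ'); apply: mem_block.
  rewrite QQQ /= (components_refine FG (block_components vF) (QG _ QQQ) (mem_block vF) vQ) //.
have le : (#|hits QQ (E :|: F)| <= #|hits QQ E| + #|inner|)%N.
  apply: (leq_trans (subset_leq_card sub)).
  by apply: (leq_trans (leq_card_setU _ _)); rewrite leq_add2l leq_imset_card.
have <- : (#|outer QQ F E| + #|inner| = #|away F E|)%N.
  rewrite -(cardsID (outer QQ F E) (away F E)); congr (_ + _)%N.
  by apply: eq_card => P; rewrite in_setI !in_outer andbA andbb.
by rewrite -addnA leq_add2l addnC.
Qed.

End Graphs.

(** * Densities of joins *)

Section Tuples.
Variables k n : nat.
Implicit Types (V W S : {set 'I_k.+1}) (x y z : ptuple k n).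
Implicit Types (X Y C : {set ptuple k n}).

Lemma tuplesP V x : reflect (forall i, (x i != None) = (i \in V)) (x \in tuples n V).
Proof.
by rewrite inE; apply: (iffP forallP) => h i; [move: (h i) => /eqP | rewrite h].
Qed.

Lemma tuples_None V x i : x \in tuples n V -> i \notin V -> x i = None.
Proof. by move=> /tuplesP/(_ i); case: (x i) => //= a <-. Qed.

Lemma restr_id V W x : x \in tuples n V -> V \subset W -> restr W x = x.
Proof.
move=> xV /subsetP VW; apply/ffunP => i; rewrite ffunE; case: ifPn => // iW.
by rewrite (tuples_None xV) //; apply: contra iW => /VW.
Qed.

Lemma restr_restr V W x : V \subset W -> restr V (restr W x) = restr V x.
Proof.
by move=> /subsetP VW; apply/ffunP => i; rewrite !ffunE; case: ifP => // /VW ->.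
Qed.

Lemma in_join V W X C x : (x \in join V W X C) =
  [&& x \in tuples n (V :|: W), restr V x \in X & restr W x \in C].
Proof. by rewrite in_set. Qed.

Lemma in_section S X y z :
  (y \in section S X z) = (y \in tuples n S) && (glue y z \in X).
Proof. by rewrite in_set. Qed.

Lemma join_pathset V W X C : join V W X C \in pathsets n (V :|: W).
Proof. by rewrite powersetE; apply/subsetP => x; rewrite in_join => /and3P[]. Qed.

Lemma pathset_tuples V X x : X \in pathsets n V -> x \in X -> x \in tuples n V.
Proof. by rewrite powersetE => /subsetP; apply. Qed.

Lemma card_tuples V : #|tuples n V| = (n ^ #|V|)%N.
Proof.
pose F (i : 'I_k.+1) := if i \in V then [pred a : option 'I_n | a != None]
  else [pred a : option 'I_n | a == None].
have -> : #|tuples n V| = #|family F|.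
  apply: eq_card => x; apply/tuplesP/familyP => h i; have := h i;
  rewrite /F; case: (i \in V); rewrite !inE //; case: (x i) => //.
rewrite card_family foldrE big_map big_enum /= (bigID (mem V)) /=.
rewrite [X in (_ * X)%N]big1 ?muln1 => [|i /negbTE iV]; last first.
  by rewrite /F iV (@eq_card1 _ None).
rewrite (eq_bigr (fun=> n)) ?prod_nat_const // => i iV.
rewrite /F iV; have := cardC1 (None : option 'I_n); rewrite card_option card_ord /= => e.
by apply: etrans e; apply: eq_card => a; rewrite !inE.
Qed.

Lemma tuples_inhabited V : (1 <= n)%N -> exists z, z \in tuples n V.
Proof.
move=> n1; apply/set0Pn; rewrite -card_gt0 card_tuples expn_gt0; lia.
Qed.

Lemma restr_set0 x : restr set0 x = [ffun=> None].
Proof. by apply/ffunP => i; rewrite !ffunE inE. Qed.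

Lemma tuples_set0 x : (x \in tuples n set0) = (x == [ffun=> None]).
Proof.
apply/tuplesP/eqP => [h|-> i]; last by rewrite ffunE inE.
by apply/ffunP => i; have := h i; rewrite inE ffunE; case: (x i).
Qed.

(* A point of the join is determined by its restrictions to [V], to
   [W :\: S :\: V] and to [S]; given the first two, the last one ranges over a
   single section of [C]. *)
Lemma card_join V W S X C m :
  X \in pathsets n V -> C \in pathsets n W -> S \subset W -> [disjoint S & V] ->
  (forall z, z \in tuples n (W :\: S) -> (#|section S C z| <= m)%N) ->
  (#|join V W X C| <= #|X| * n ^ #|W :\: S :\: V| * m)%N.
Proof.
move=> XV CW SW SV mC.
pose h x := (restr V x, restr (W :\: S :\: V) x).
have hcod : h @: join V W X C \subset setX X (tuples n (W :\: S :\: V)).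
  apply/subsetP => _ /imsetP[x + ->]; rewrite in_join => /and3P[xVW xX _].
  rewrite in_setX xX /=; apply: restr_tuples xVW.
  by apply/subsetP => i; rewrite !inE => /and3P[_ _ ->]; rewrite orbT.
have := subset_leq_card hcod; rewrite cardsX card_tuples => le.
rewrite -sum1_card (partition_big_imset h) /=.
apply: (@leq_trans (\sum_(p in h @: join V W X C) m)%N); last first.
  by rewrite sum_nat_const leq_mul2r le orbT.
apply: leq_sum => _ /imsetP[x xJ ->].
have := xJ; rewrite in_join => /and3P[xVW xX xC].
have zW : restr (W :\: S) x \in tuples n (W :\: S).
  by apply: restr_tuples xVW; apply/subsetP => i; rewrite !inE => /andP[_ ->]; rewrite orbT.
apply: leq_trans (mC _ zW).
rewrite sum1dep_card.
have inj : {in [set y in join V W X C | h y == h x] &, injective (@restr k n S)}.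
  move=> y y' /setIdP[yJ /eqP hy] /setIdP[y'J /eqP hy'].
  have [hV hR] : restr V y = restr V y' /\
      restr (W :\: S :\: V) y = restr (W :\: S :\: V) y'.
    by move: hy hy' => -[-> ->] -[-> ->].
  have yT : y \in tuples n (V :|: W) by move: yJ; rewrite in_join => /and3P[].
  have y'T : y' \in tuples n (V :|: W) by move: y'J; rewrite in_join => /and3P[].
  move=> hS; apply/ffunP => i.
  move/ffunP/(_ i): hV; move/ffunP/(_ i): hR; move/ffunP/(_ i): hS.
  rewrite !ffunE !in_setD; case: (boolP (i \in V)) => //= iV.
  case: (boolP (i \in S)) => //= iS; case: (boolP (i \in W)) => //= iW _ _ _.
  by rewrite (tuples_None yT) ?(tuples_None y'T) // in_setU negb_or iV.
rewrite -(card_in_imset inj); apply/subset_leq_card/subsetP => _ /imsetP[y + ->].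
move=> /setIdP[yJ /eqP hy].
have := yJ; rewrite in_join => /and3P[yVW yX yC].
rewrite in_section (restr_tuples _ yVW); last by rewrite subsetU // SW orbT.
suff -> : glue (restr S y) (restr (W :\: S) x) = restr W y by [].
case: hy => hV hR; apply/ffunP => i.
move/ffunP/(_ i): hV; move/ffunP/(_ i): hR; rewrite !ffunE !in_setD.
case: (boolP (i \in S)) => /= iS.
  have iW : i \in W by apply: (subsetP SW).
  by rewrite iW; case: (y i).
case: (boolP (i \in V)) => /= iV; first by move=> _ ->.
by case: (i \in W).
Qed.

Variable R : realType.
Hypothesis n1 : (1 <= n)%N.

Lemma n_gt0 : 0 < n%:R :> R. Proof. by rewrite ltr0n. Qed.

Lemma density_ge0 V X : 0 <= density R V X.
Proof. by rewrite divr_ge0 ?exprn_ge0 ?ler0n. Qed.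

Lemma mu_ge0 V S X : 0 <= mu R V S X.
Proof. by rewrite divr_ge0 ?exprn_ge0 ?ler0n. Qed.

Lemma mu_attained V S X : exists2 z, z \in tuples n (V :\: S) &
  mu R V S X = density R S (section S X z).
Proof.
have [|z zV e] := @eq_bigmax_cond _ (mem (tuples n (V :\: S))) (fun z => #|section S X z|).
  by have [z zV] := tuples_inhabited (V :\: S) n1; apply/card_gt0P; exists z.
by exists z => //; rewrite /mu e.
Qed.

Lemma density_section V S X z : z \in tuples n (V :\: S) ->
  density R S (section S X z) <= mu R V S X.
Proof.
move=> zV; rewrite ler_pM2r ?invr_gt0 ?exprn_gt0 ?n_gt0 // ler_nat.
exact: (@leq_bigmax_cond _ (mem (tuples n (V :\: S))) (fun z => #|section S X z|)).
Qed.

(** Normalize [card_join]: [V :|: W] is the disjoint union of [V], [W :\: S :\: V] and [S], and the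
    middle part, bounded trivially, cancels. *)
Lemma density_join V W S X C :
  X \in pathsets n V -> C \in pathsets n W -> S \subset W -> [disjoint S & V] ->
  density R (V :|: W) (join V W X C) <= density R V X * mu R W S C.
Proof.
move=> XV CW SW SV.
set m := (\max_(z in tuples n (W :\: S)) #|section S C z|)%N.
have le : (#|join V W X C| <= #|X| * n ^ #|W :\: S :\: V| * m)%N.
  apply: card_join => // z zW.
  exact: (@leq_bigmax_cond _ (mem (tuples n (W :\: S))) (fun z => #|section S C z|)).
rewrite /density /mu -/m.
have -> : #|V :|: W| = (#|V| + (#|W :\: S :\: V| + #|S|))%N.
  have -> : V :|: W = V :|: ((W :\: S :\: V) :|: S).
    apply/setP => i; rewrite !inE; case: (boolP (i \in V)) => //= iV.
    by case: (boolP (i \in S)) => /= iS; rewrite ?orbF ?orbT // (subsetP SW).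
  rewrite !cardsU.
  have -> : V :&: (W :\: S :\: V :|: S) = set0.
    apply/setP => i; rewrite !inE; case: (boolP (i \in V)) => //= iV.
    apply/negbTE/negP => iS; have /pred0P/(_ i) /= := SV; by rewrite iS iV.
  have -> : (W :\: S :\: V) :&: S = set0.
    by apply/setP => i; rewrite !inE; case: (i \in S); rewrite ?andbF.
  by rewrite cards0 !subn0.
have p (j : nat) : (n%:R : R) ^+ j != 0 by rewrite expf_neq0 // gt_eqF // n_gt0.
rewrite mulf_div -exprD ler_pdivrMr ?exprn_gt0 ?n_gt0 //.
have -> : (n%:R : R) ^+ (#|V| + (#|W :\: S :\: V| + #|S|)) =
  n%:R ^+ #|W :\: S :\: V| * n%:R ^+ (#|V| + #|S|) by rewrite -exprD; congr (_ ^+ _); lia.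
rewrite [leRHS]mulrA mulrAC divfK // mulrAC -natrX -!natrM ler_nat mulnAC.
by apply: leq_trans le _; rewrite mulnAC.
Qed.

End Tuples.

(** * Powers of [ntilde] and joins with small pathsets *)

Section Ntilde.
Variables (R : realType) (k n : nat).
Hypotheses (n1 : (1 <= n)%N) (k2 : (2 <= k)%N).
Local Notation nt := (ntilde R n k).

(** As [k >= 2], [log k >= 1], so the exponent [1 - epsilon] is nonnegative. *)
Lemma ntilde_ge1 : 1 <= nt.
Proof.
rewrite -[leLHS](@powRr0 R n%:R) /ntilde ler_powR ?ler1n // subr_ge0.
have ln2 : 0 < ln (2 : R) by rewrite ln_gt0 // ltr1n.
rewrite /epsilon /log2 lne_EFin ?ltr0n ?(leq_trans _ k2) // -EFinM /=.
rewrite invf_le1 ?divr_gt0 // ?ln_gt0 ?ltr1n // ler_pdivlMr // mul1r.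
by rewrite ler_ln ?posrE ?ltr0n ?(leq_trans _ k2) // ler_nat.
Qed.

Lemma ntilde_powRD (r s : R) : nt `^ (r + s) = nt `^ r * nt `^ s.
Proof. by rewrite powRD // (gt_eqF (ntilde_gt0 R k n1)) implybT. Qed.

Lemma ntilde_powR_gt0 (r : R) : 0 < nt `^ r.
Proof. by apply: powR_gt0; apply: ntilde_gt0. Qed.

Lemma ntilde_powRN (r : R) : nt `^ (- r) * nt `^ r = 1.
Proof. by rewrite -ntilde_powRD addNr powRr0. Qed.

Lemma ntilde_powR_le (r s : R) : r <= s -> nt `^ r <= nt `^ s.
Proof. by move=> rs; rewrite ler_powR ?ntilde_ge1. Qed.

Implicit Types (E F G : {set 'I_k}) (X Y C : {set ptuple k n}).

Lemma cover_away_sub F E : cover (away F E) \subset vertices F.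
Proof.
apply/bigcupsP => P; rewrite in_away => /andP[PF _].
exact: components_sub_vertices.
Qed.

Lemma cover_away_disjoint F E : [disjoint cover (away F E) & vertices E].
Proof.
apply/pred0P => v /=; apply/negP => /andP[/bigcupP[P]].
by rewrite in_away => /andP[_ /pred0P/(_ v) /= PE] vP vE; rewrite vP vE in PE.
Qed.

Lemma mu_set0 V X : mu R V set0 X <= 1.
Proof.
have [z _ ->] := mu_attained R n1 V set0 X.
rewrite /density cards0 expr0 divr1 -[leRHS]/(1%:R) ler_nat.
rewrite -(expn0 n) -(@cards0 'I_k.+1) -card_tuples.
by apply/subset_leq_card/subsetP => y; rewrite in_section => /andP[].
Qed.

Lemma mu_away F E C : small R F C ->
  mu R (vertices F) (cover (away F E)) C <= nt `^ (- #|away F E|%:R).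
Proof.
(* The case [t = 0] is not part of [small]; there the trivial bound serves. *)
move=> [_ sm]; have [->|a0] := eqVneq (away F E) set0.
  by rewrite /cover big_set0 cards0 oppr0 powRr0 mu_set0.
have aF : away F E \subset components F by apply/subsetP => P; rewrite in_away => /andP[].
rewrite powRN powR_mulrn ?(ltW (ntilde_gt0 R k n1)) //; apply: sm.
  by rewrite card_gt0 a0 subset_leq_card.
by exists (away F E) => //; rewrite aF eqxx.
Qed.

Lemma density_join_small E F X C : X \in pathsets n (vertices E) -> small R F C ->
  density R (vertices (E :|: F)) (join (vertices E) (vertices F) X C) <=
  density R (vertices E) X * nt `^ (- #|away F E|%:R).
Proof.
move=> XE smC; rewrite verticesU.
apply: le_trans (ler_wpM2l (density_ge0 _ _ _) (mu_away E smC)).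
by apply: density_join; rewrite ?cover_away_sub ?cover_away_disjoint //; case: smC.
Qed.

Definition factor : Type := ({set 'I_k} * {set ptuple k n})%type.
Implicit Types (L : seq factor).

Definition union_edges (s : seq {set 'I_k}) := \bigcup_(F <- s) F.

(** The join of [X] with all factors at once. Imposing all conditions on a single tuple makes the
    order of the factors immaterial; [bigjoin_cons] recovers the iterated join. *)
Definition bigjoin E X L : {set ptuple k n} :=
  [set x in tuples n (vertices (E :|: union_edges (unzip1 L))) |
    (restr (vertices E) x \in X) && all (fun p : factor => restr (vertices p.1) x \in p.2) L].

Lemma in_bigjoin E X L x : (x \in bigjoin E X L) =
  [&& x \in tuples n (vertices (E :|: union_edges (unzip1 L))),
    restr (vertices E) x \in X &
    all (fun p : factor => restr (vertices p.1) x \in p.2) L].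
Proof. by rewrite in_set. Qed.

Lemma bigjoin_cons E X p L : bigjoin E X (p :: L) =
  bigjoin (E :|: p.1) (join (vertices E) (vertices p.1) X p.2) L.
Proof.
apply/setP => x; rewrite !in_bigjoin in_join /= /union_edges big_cons setUA.
set W := vertices _; case: (boolP (x \in tuples n W)) => //= xW.
rewrite verticesU !restr_restr ?subsetUl ?subsetUr //.
rewrite (restr_tuples _ xW) /=; last by rewrite /W !verticesU -setUA setUA subsetUl.
by rewrite -andbA.
Qed.

(** The factors are joined one at a time. By [card_outer_hits] each has at least as many components
    away from what is already joined as there are members of [QQ] hit for the first time, and the
    exponents telescope. *)
Lemma density_bigjoin E X L G (QQ : {set {set 'I_k.+1}}) : QQ \subset components G ->
  X \in pathsets n (vertices E) -> (forall p, p \in L -> small R p.1 p.2) ->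
  E :|: union_edges (unzip1 L) \subset G ->
  density R (vertices (E :|: union_edges (unzip1 L))) (bigjoin E X L) <=
  density R (vertices E) X *
    nt `^ (#|hits QQ E|%:R - #|hits QQ (E :|: union_edges (unzip1 L))|%:R).
Proof.
move=> QG; elim: L E X => [|p L IH] E X XE sm LG.
  rewrite /union_edges big_nil setU0 subrr powRr0 mulr1.
  rewrite ler_pM2r ?invr_gt0 ?exprn_gt0 ?n_gt0 // ler_nat subset_leq_card //.
  apply/subsetP => x; rewrite in_bigjoin /union_edges big_nil setU0 => /and3P[xE + _].
  by rewrite (restr_id xE).
have eU : E :|: union_edges (unzip1 (p :: L)) = (E :|: p.1) :|: union_edges (unzip1 L).
  by rewrite /union_edges /= big_cons setUA.
rewrite eU in LG *; rewrite bigjoin_cons.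
have smp : small R p.1 p.2 by apply: sm; rewrite mem_head.
have JE : join (vertices E) (vertices p.1) X p.2 \in pathsets n (vertices (E :|: p.1)).
  by rewrite verticesU join_pathset.
have smL q : q \in L -> small R q.1 q.2 by move=> qL; apply: sm; rewrite in_cons qL orbT.
apply: le_trans (IH _ _ JE smL LG) _.
apply: le_trans (ler_wpM2r (ltW (ntilde_powR_gt0 _)) (density_join_small XE smp)) _.
rewrite -mulrA ler_wpM2l ?density_ge0 // -ntilde_powRD ntilde_powR_le //.
have pG : p.1 \subset G by apply: subset_trans LG; rewrite -setUA setUCA subsetUl.
have := leq_trans (leq_addl _ _) (card_outer_hits E pG QG).
rewrite -(ler_nat R) natrD; lra.
Qed.

End Ntilde.

(** * Coverings along a branch of a pattern *)

Section Complexity.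
Variables (R : realType) (k n : nat).
Hypotheses (n1 : (1 <= n)%N) (k2 : (2 <= k)%N).
Local Notation nt := (ntilde R n k).
Implicit Types (E F G : {set 'I_k}) (X Y : {set ptuple k n}).
Implicit Types (A B C D : tree k) (L : seq (factor k n)).
Implicit Types (S V W : {set 'I_k.+1}).

Lemma card_bigcup_le (T : finType) (I : Type) (r : seq I) (f : I -> {set T}) :
  (#|\bigcup_(i <- r) f i| <= \sum_(i <- r) #|f i|)%N.
Proof.
elim: r => [|i r IH]; first by rewrite !big_nil cards0.
by rewrite !big_cons (leq_trans (leq_card_setU _ _)) // leq_add2l.
Qed.

Lemma bigcup_seqP (T : finType) (I : eqType) (r : seq I) (f : I -> {set T}) x :
  reflect (exists2 i, i \in r & x \in f i) (x \in \bigcup_(i <- r) f i).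
Proof.
elim: r => [|i r IH]; first by rewrite big_nil inE; apply: ReflectF => -[].
rewrite big_cons in_setU; apply: (iffP orP) => [[xi|/IH[j jr xj]]|[j]].
- by exists i; rewrite ?mem_head.
- by exists j; rewrite // in_cons jr orbT.
- by rewrite in_cons => /orP[/eqP ->|jr xj]; [left|right; apply/IH; exists j].
Qed.

Lemma density_cover (I : Type) V X (r : seq I) (f : I -> {set ptuple k n}) :
  X \subset \bigcup_(i <- r) f i ->
  density R V X <= \sum_(i <- r) density R V (f i).
Proof.
move=> sub; rewrite /density -mulr_suml ler_wpM2r ?invr_ge0 ?exprn_ge0 ?ler0n //.
rewrite -natr_sum ler_nat.
exact: leq_trans (subset_leq_card sub) (card_bigcup_le _ _).
Qed.

(** Monotonicity and subadditivity together: optimal coverings of the members of [L], concatenated,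
    cover [X]. *)
Lemma tree_chi_cover A X (L : seq {set ptuple k n}) :
  (forall Y, Y \in L -> Y \in pathsets n (vertices (tree_edges A))) ->
  X \subset \bigcup_(Y <- L) Y ->
  (tree_chi R A X <= \sum_(Y <- L) tree_chi R A Y)%N.
Proof.
case: A => [e|B D] LA XL.
  exact: leq_trans (subset_leq_card XL) (card_bigcup_le _ _).
have XA : X \in pathsets n (vertices (tree_edges (Node B D))).
  rewrite powersetE; apply/subsetP => x /(subsetP XL).
  by case/bigcup_seqP => Y /LA YA; apply: pathset_tuples.
suff [s [cs1 cs2] <-] : exists2 s,
    covering R (tree_edges B) (tree_edges D) (\bigcup_(Y <- L) Y) s &
    (\sum_(p <- s) (tree_chi R B p.1 + tree_chi R D p.2) =
     \sum_(Y <- L) tree_chi R (Node B D) Y)%N.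
  have [_] := chi_node_min R n1 k2 XA; apply; split=> //.
  exact: subset_trans XL cs2.
move: LA {XA XL}; elim: L => [|Y L IH] LA.
  exists [::]; last by rewrite !big_nil.
  by split=> [//|]; rewrite big_nil sub0set.
have [|s1 [c1 c2] e1] := IH; first by move=> Z ZL; apply: LA; rewrite in_cons ZL orbT.
have [[s2 [d1 d2] e2] _] := chi_node_min R n1 k2 (LA Y (mem_head _ _)).
exists (s2 ++ s1).
  split; first by move=> p; rewrite mem_cat => /orP[/d1|/c1].
  by rewrite big_cons big_cat /= setUSS.
by rewrite big_cat big_cons /= e1 -e2.
Qed.

(** The list records the siblings along the path from the root down to [D], topmost first. Only
    their edge sets matter for the bounds. *)
Inductive branch D : tree k -> seq {set 'I_k} -> Prop :=
| branch_refl : branch D D [::]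
| branch_left B C s : branch D B s -> branch D (Node B C) (tree_edges C :: s)
| branch_right B C s : branch D C s -> branch D (Node B C) (tree_edges B :: s).

Lemma branch_trans D B A s t : branch D B s -> branch B A t -> branch D A (t ++ s).
Proof.
by move=> DB; elim=> [|B' C' s' _ IH|B' C' s' _ IH] //=; [apply: branch_left|apply: branch_right].
Qed.

Lemma branch_edges D A s : branch D A s -> tree_edges A = tree_edges D :|: union_edges s.
Proof.
elim=> [|B C s' _ IH|B C s' _ IH] /=; rewrite /union_edges ?big_nil ?setU0 // big_cons IH.
  by rewrite -setUA; congr (_ :|: _); rewrite setUC.
by rewrite setUCA.
Qed.

Lemma branch_vertices_sub D B s F : branch D B s -> F \in tree_edges D :: s ->
  vertices F \subset vertices (tree_edges B).
Proof.
move=> DB Fs; apply: verticesS; rewrite (branch_edges DB); apply/subsetP => e eF.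
move: Fs; rewrite in_cons => /orP[/eqP <-|Fs]; rewrite in_setU ?eF //.
by apply/orP; right; apply/bigcup_seqP; exists F.
Qed.

(** The result of substituting optimal coverings into one another from [A] down to [D]. The costs of
    the siblings are dropped; only their smallness is kept. *)
Definition flattens D A s X := exists T : seq ({set ptuple k n} * seq (factor k n)),
  [/\ forall t, t \in T -> [/\ t.1 \in pathsets n (vertices (tree_edges D)),
        unzip1 t.2 = s & forall p, p \in t.2 -> small R p.1 p.2],
     X \subset \bigcup_(t <- T) bigjoin (tree_edges D) t.1 t.2 &
     (\sum_(t <- T) tree_chi R D t.1 <= tree_chi R A X)%N].

Lemma flattens_node D B C s X :
  branch D B s ->
  (forall Y, Y \in pathsets n (vertices (tree_edges B)) -> flattens D B s Y) ->
  X \in pathsets n (vertices (tree_edges (Node B C))) ->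
  flattens D (Node B C) (tree_edges C :: s) X.
Proof.
move=> DB IH XA; have [[r [r1 r2] e] _] := chi_node_min R n1 k2 XA.
rewrite /flattens {}e.
(* The claim is stated for the whole union of joins, which allows induction on the covering [r]. *)
suff [T [T1 T2 T3]] : exists T : seq ({set ptuple k n} * seq (factor k n)),
  [/\ forall t, t \in T -> [/\ t.1 \in pathsets n (vertices (tree_edges D)),
        unzip1 t.2 = tree_edges C :: s & forall p, p \in t.2 -> small R p.1 p.2],
     (\bigcup_(p <- r) join (vertices (tree_edges B)) (vertices (tree_edges C)) p.1 p.2)
       \subset \bigcup_(t <- T) bigjoin (tree_edges D) t.1 t.2 &
     (\sum_(t <- T) tree_chi R D t.1 <=
        \sum_(p <- r) (tree_chi R B p.1 + tree_chi R C p.2))%N].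
  by exists T; split=> //; apply: subset_trans T2.
move: r1; clear r2 XA X; elim: r => [|p r IHr] r1.
  by exists [::]; split=> //; rewrite !big_nil // sub0set.
have [|T [T1 T2 T3]] := IHr.
  by move=> q qr; apply: r1; rewrite in_cons qr orbT.
have [sm1 sm2] := r1 p (mem_head _ _).
have [U [U1 U2 U3]] := IH p.1 (proj1 sm1).
(* The pathset of [C] becomes one more factor in each term obtained for [B]. *)
exists ([seq (t.1, (tree_edges C, p.2) :: t.2) | t <- U] ++ T); split.
- move=> t; rewrite mem_cat => /orP[|/T1//].
  case/mapP => u /U1[u1 u2 u3] -> /=; split=> //; first by rewrite u2.
  by move=> q; rewrite in_cons => /orP[/eqP ->|/u3].
- rewrite big_cons big_cat setUSS //= big_map /=.
  apply/subsetP => x; rewrite in_join => /and3P[xV xB xC].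
  have := subsetP U2 _ xB; case/bigcup_seqP => t tU.
  rewrite in_bigjoin => /and3P[y1 y2 y3]; apply/bigcup_seqP; exists t => //.
  have [_ u2 _] := U1 t tU.
  have sub F (Fs : F \in tree_edges D :: s) := branch_vertices_sub DB Fs.
  rewrite in_bigjoin /= u2 xC; apply/and3P; split.
  + rewrite /union_edges big_cons setUCA -/(union_edges s) -(branch_edges DB).
    by rewrite verticesU setUC.
  + by move: y2; rewrite restr_restr // sub // mem_head.
  + apply/allP => q qt; move/allP/(_ q qt): y3; rewrite restr_restr // sub //.
    by rewrite in_cons -u2; apply/orP; right; apply/mapP; exists q.
- rewrite big_cat big_cons big_map /= leq_add //.
  exact: leq_trans U3 (leq_addr _ _).
Qed.

Lemma branch_flattens D A s X : branch D A s ->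
  X \in pathsets n (vertices (tree_edges A)) -> flattens D A s X.
Proof.
move=> DA; elim: DA X => [|B C s' DB IH|B C s' DB IH] X XA.
- exists [:: (X, [::])]; split; last by rewrite big_seq1.
    by move=> t; rewrite inE => /eqP ->.
  rewrite big_seq1; apply/subsetP => x xX; rewrite in_bigjoin /= /union_edges big_nil setU0.
  have xD := pathset_tuples XA xX.
  by rewrite xD (restr_id xD) ?xX.
- exact: flattens_node.
(* A step to the right child is a step to the left one after exchanging the children. *)
- rewrite /flattens chi_nodeC; apply: flattens_node => //.
  by move: XA => /=; rewrite setUC.
Qed.

Definition bounded A (e : R) := forall X, X \in pathsets n (vertices (tree_edges A)) ->
  nt `^ e * density R (vertices (tree_edges A)) X <= (tree_chi R A X)%:R.

Lemma bounded_le A e e' : e' <= e -> bounded A e -> bounded A e'.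
Proof.
move=> le bA X XA; apply: le_trans (bA X XA).
by rewrite ler_wpM2r ?density_ge0 // ntilde_powR_le.
Qed.

(** Joining a factor twice is harmless, so any sibling can be brought to the front of the list. *)
Lemma bigjoin_dup E X L p : p \in L ->
  bigjoin E X L \subset bigjoin E X (p :: L) /\
  union_edges (unzip1 (p :: L)) = union_edges (unzip1 L).
Proof.
move=> pL.
have e : union_edges (unzip1 (p :: L)) = union_edges (unzip1 L).
  rewrite /union_edges /= big_cons; apply/setUidPr; rewrite bigcup_seq.
  by apply: (bigcup_sup p.1); apply/mapP; exists p.
split=> //; apply/subsetP => x; rewrite !in_bigjoin e => /and3P[-> -> h] /=.
by rewrite h (allP h).
Qed.

(** After flattening, [D] contributes its components. Every member of [QQ] not hit by [D] is hit
    later and yields a factor [1/nt], and a chosen sibling yields [q] more; [q = 0] covers the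
    absence of a choice. *)
Lemma bounded_branch D A s (QQ : {set {set 'I_k.+1}}) (q : nat) (phi : R) :
  branch D A s -> QQ \subset components (tree_edges A) ->
  q = 0%N \/ (exists2 F, F \in s & q = #|outer QQ F (tree_edges D)|) ->
  bounded D (phi + (ncomp (tree_edges D))%:R) ->
  bounded A (phi + #|outer QQ (tree_edges D) set0|%:R + q%:R + #|QQ|%:R).
Proof.
move=> DA QA hq bD X XA; have [T [T1 T2 T3]] := branch_flattens DA XA.
have eA := branch_edges DA.
apply: (@le_trans _ _ (\sum_(t <- T) tree_chi R D t.1)%N%:R); last by rewrite ler_nat.
apply: le_trans (ler_wpM2l (powR_ge0 _ _) (density_cover _ T2)) _.
rewrite mulr_sumr natr_sum big_seq [leRHS]big_seq; apply: ler_sum => t tT.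
have [tD tU tsm] := T1 t tT; apply: le_trans (bD _ tD).
(* The components of [D] outside the members of [QQ], together with one for each member that [D]
   hits, number at most [ncomp (tree_edges D)]. *)
have oD := card_outer_hits set0 (subsetUl (tree_edges D) (union_edges s)).
move: oD; rewrite -eA => /(_ _ QA); rewrite set0U away0 hits0 cards0 addn0 => oD.
have fA := hits_full QA.
have {oD} : #|outer QQ (tree_edges D) set0|%:R + #|hits QQ (tree_edges D)|%:R <=
    (ncomp (tree_edges D))%:R :> R by rewrite -natrD ler_nat.
case: hq => [->|[F Fs ->]] oD.
  have := @density_bigjoin R k n n1 k2 (tree_edges D) t.1 t.2 _ QQ QA tD tsm.
  rewrite tU -eA fA => le0; have {le0} le := le0 (subxx _).
  apply: le_trans (ler_wpM2l (powR_ge0 _ _) le) _.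
  rewrite mulrCA mulrC ler_wpM2r ?density_ge0 // -ntilde_powRD // ntilde_powR_le //.
  lra.
(* The chosen sibling is duplicated at the front, so that its components are measured against [D]
   alone. *)
have : F \in unzip1 t.2 by rewrite tU.
case/mapP => p pt eF; have [sub eu] := bigjoin_dup (tree_edges D) t.1 pt.
have pA : p.1 \subset tree_edges A.
  rewrite eA; apply: subset_trans (subsetUr _ _); rewrite /union_edges bigcup_seq -eF.
  exact: (bigcup_sup F).
have oC := card_outer_hits (tree_edges D) pA QA.
have smp := tsm p pt.
have jD : join (vertices (tree_edges D)) (vertices p.1) t.1 p.2 \in
    pathsets n (vertices (tree_edges D :|: p.1)) by rewrite verticesU join_pathset.
have eU : tree_edges D :|: p.1 :|: union_edges (unzip1 t.2) = tree_edges A.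
  by rewrite eA -tU -[in RHS]eu /= /union_edges big_cons setUA.
have := @density_bigjoin R k n n1 k2 _ _ t.2 _ QQ QA jD tsm.
rewrite eU fA -bigjoin_cons => le0; have {le0} le := le0 (subxx _).
have le2 := density_join_small n1 tD smp.
have le3 : density R (vertices (tree_edges A)) (bigjoin (tree_edges D) t.1 t.2) <=
    density R (vertices (tree_edges A)) (bigjoin (tree_edges D) t.1 (p :: t.2)).
  by rewrite ler_wpM2r ?invr_ge0 ?exprn_ge0 ?ler0n // ler_nat subset_leq_card.
apply: le_trans (ler_wpM2l (powR_ge0 _ _) (le_trans le3 le)) _.
apply: le_trans (ler_wpM2l (powR_ge0 _ _)
  (ler_wpM2r (powR_ge0 _ _) le2)) _.
rewrite -mulrA -ntilde_powRD // mulrCA mulrC ler_wpM2r ?density_ge0 //.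
rewrite -ntilde_powRD // ntilde_powR_le // eF.
have : #|outer QQ p.1 (tree_edges D)|%:R + #|hits QQ (tree_edges D :|: p.1)|%:R <=
    #|away p.1 (tree_edges D)|%:R + #|hits QQ (tree_edges D)|%:R :> R.
  by rewrite -!natrD ler_nat.
lra.
Qed.

End Complexity.

(** * Restriction to a union of components *)

Section RestrictGraph.
Variable k : nat.
Implicit Types (E F : {set 'I_k}) (S P : {set 'I_k.+1}).

(** Equivalently, [S] meets [vertices E] in a union of components of [E]. *)
Definition edge_closed S E := forall e : 'I_k, e \in E -> (src e \in S) = (dst e \in S).

Definition restrict_edges S E := [set e in E | src e \in S].

Lemma vertices_restrict S E : edge_closed S E ->
  vertices (restrict_edges S E) = vertices E :&: S.
Proof.
move=> cl; apply/setP => v; rewrite in_setI; apply/verticesP/andP => [[e /setIdP[eE eS] ev]|].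
  split; first by apply/verticesP; exists e.
  by case/orP: ev => /eqP ->; rewrite -?cl.
move=> [/verticesP[e eE ev] vS]; exists e => //; apply/setIdP; split=> //.
by case/orP: ev vS => /eqP ->; rewrite -?cl.
Qed.

Lemma restrict_sub S E : restrict_edges S E \subset E.
Proof. by apply/subsetP => e /setIdP[]. Qed.

Lemma edge_closedS S E F : E \subset F -> edge_closed S F -> edge_closed S E.
Proof. by move=> /subsetP EF cl e /EF /cl. Qed.

Lemma connect_restrict S E u v : edge_closed S E -> u \in S ->
  connect (adj E) u v -> (v \in S) && connect (adj (restrict_edges S E)) u v.
Proof.
move=> cl uS /connectP[p pth ->]; elim: p u uS pth => [|w p IH] u uS /=.
  by rewrite uS connect0.
case/andP => /adjP[e eE uw] pth.
have wS : w \in S by case: uw uS => -[-> ->]; rewrite cl.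
have /andP[-> wp] := IH w wS pth; rewrite /= (connect_trans _ wp) //.
apply: connect1; apply/adjP; exists e => //; apply/setIdP; split=> //.
by case: uw uS wS => -[-> ->].
Qed.

Lemma components_restrict S E : edge_closed S E ->
  components (restrict_edges S E) = [set P in components E | P \subset S].
Proof.
move=> cl.
have beq v : v \in S -> block (restrict_edges S E) v = block E v.
  move=> vS; apply/setP => x; rewrite !in_block vertices_restrict // in_setI.
  apply/andP/andP => [[/andP[xE xS] vx]|[xE vx]].
    by split=> //; apply: connectS vx; apply: restrict_sub.
  by have /andP[-> ->] := connect_restrict cl vS vx; rewrite xE.
apply/setP => P; apply/componentsP/setIdP => [[v + ->]|[/componentsP[v vE ->] bS]].
  rewrite vertices_restrict // => /setIP[vE vS]; rewrite beq //; split.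
    exact: block_components.
  apply/subsetP => x; rewrite in_block => /andP[_ vx].
  by have /andP[] := connect_restrict cl vS vx.
have vS : v \in S by apply: (subsetP bS); apply: mem_block.
by exists v; rewrite ?beq // vertices_restrict // in_setI vE.
Qed.

Lemma cover_away_closed E F : edge_closed (cover (away F E)) F.
Proof.
move=> e eF; have c := connect1 (adj_edge eF).
apply/bigcupP/bigcupP => -[P PA eP]; exists P => //;
  have PF : P \in components F by move: PA; rewrite in_away => /andP[].
  by rewrite (components_block PF eP) in_block dst_vertices.
by rewrite (components_block PF eP) in_block src_vertices //= adj_connect_sym.
Qed.

Lemma components_restrict_away E F :
  components (restrict_edges (cover (away F E)) F) = away F E.
Proof.
rewrite components_restrict; last exact: cover_away_closed.
apply/setP => P; apply/setIdP/idP => [[PF PS]|PA].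
  have [v vP] := components_nonempty PF.
  have /bigcupP[Q QA vQ] := subsetP PS _ vP.
  have QF : Q \in components F by move: QA; rewrite in_away => /andP[].
  by rewrite (components_eq PF QF vP vQ).
split; first by move: PA; rewrite in_away => /andP[].
exact: (bigcup_sup P).
Qed.

(** The value is a [pattern] because no leaf may survive. Testing [src e] is enough for the sets [S]
    of interest, which no edge leaves. *)
Fixpoint restrict_tree S (A : tree k) : pattern k :=
  match A with
  | Leaf e => if src e \in S then Some (Leaf e) else None
  | Node B C =>
    match restrict_tree S B, restrict_tree S C with
    | Some B', Some C' => Some (Node B' C')
    | None, T => T
    | T, None => T
    end
  end.

Lemma restrict_tree_edges S A :
  pattern_edges (restrict_tree S A) = restrict_edges S (tree_edges A).
Proof.
elim: A => [e|B IB C IC] /=.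
  apply/setP => f; apply/idP/setIdP; last first.
    by move=> [/set1P -> ->]; rewrite /= set11.
  by case: ifP => [eS /set1P ->|]; rewrite /= ?inE // set11.
have -> : restrict_edges S (tree_edges B :|: tree_edges C) =
    restrict_edges S (tree_edges B) :|: restrict_edges S (tree_edges C).
  by apply/setP => f; rewrite !inE andb_orl.
rewrite -IB -IC; case: (restrict_tree S B) => [B'|]; case: (restrict_tree S C) => [C'|] //=;
by rewrite ?setU0 ?set0U.
Qed.

Fixpoint tree_size (A : tree k) : nat :=
  if A is Node B C then (tree_size B + tree_size C).+1 else 1%N.

(** This lets an induction on size reach restricted patterns. *)
Lemma restrict_tree_size S A A' :
  restrict_tree S A = Some A' -> (tree_size A' <= tree_size A)%N.
Proof.
elim: A A' => [e|B IB C IC] A' /=; first by case: ifP => // _ [<-].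
case: (restrict_tree S B) IB => [B'|] IB; case: (restrict_tree S C) IC => [C'|] IC //.
- by move=> [<-] /=; rewrite ltnS leq_add ?IB ?IC.
- by move=> [<-]; apply: leq_trans (IB _ erefl) _; lia.
- by move=> [<-]; apply: leq_trans (IC _ erefl) _; lia.
Qed.

End RestrictGraph.

(** * Pathset complexity of restricted patterns *)

Section RestrictComplexity.
Variables (R : realType) (k n : nat).
Hypotheses (n1 : (1 <= n)%N) (k2 : (2 <= k)%N).
Local Notation nt := (ntilde R n k).
Implicit Types (E F G : {set 'I_k}) (X Y : {set ptuple k n}).
Implicit Types (A B C D : tree k) (L : seq (factor k n)).
Implicit Types (S V W : {set 'I_k.+1}) (x y z : ptuple k n).

Lemma glueA x y z : glue x (glue y z) = glue (glue x y) z.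
Proof. by apply/ffunP => i; rewrite !ffunE; case: (x i). Qed.

Lemma restr_glue S x y : restr S (glue x y) = glue (restr S x) (restr S y).
Proof. by apply/ffunP => i; rewrite !ffunE; case: (i \in S). Qed.

Lemma section_pathset S X z : section S X z \in pathsets n S.
Proof. by rewrite powersetE; apply/subsetP => y; rewrite in_section => /andP[]. Qed.

Lemma card_section_le S X z : (#|section S X z| <= #|X|)%N.
Proof.
have inj : {in section S X z &, injective (fun y => glue y z)}.
  move=> y y'; rewrite !in_section => /andP[yS _] /andP[y'S _] /ffunP e.
  apply/ffunP => i; have := e i; rewrite !ffunE.
  have := tuplesP _ _ yS i; have := tuplesP _ _ y'S i.
  by case: (y i) => [a|] <-; case: (y' i).
rewrite -(card_in_imset inj); apply/subset_leq_card/subsetP => _ /imsetP[y + ->].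
by rewrite in_section => /andP[].
Qed.

(** Unions of components of the restricted graph are unions of components of [F], and a section of a
    section of [X] lies in a section of [X]. *)
Lemma small_section F X S z : edge_closed S F -> small R F X ->
  z \in tuples n (vertices F :\: S) ->
  small R (restrict_edges S F) (section (vertices F :&: S) X z).
Proof.
move=> cl [XF sm] zF; split; first by rewrite vertices_restrict // section_pathset.
move=> t S' /andP[t1 _] [T /andP[TF Tt] S'T].
have TF' : T \subset components F.
  apply: subset_trans TF _; rewrite components_restrict //.
  by apply/subsetP => P /setIdP[].
have tF : (t <= ncomp F)%N by rewrite -(eqP Tt) subset_leq_card.
apply: le_trans (sm t S' _ _); last 2 first.
- by rewrite t1.
- by exists T; rewrite // TF'.
rewrite vertices_restrict //.
have S'S : S' \subset vertices F :&: S.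
  rewrite S'T -vertices_restrict //; apply/bigcupsP => P /(subsetP TF).
  exact: components_sub_vertices.
have [y yS ->] := mu_attained R n1 (vertices F :&: S) S' (section (vertices F :&: S) X z).
have gF : glue y z \in tuples n (vertices F :\: S').
  have -> : vertices F :\: S' = (vertices F :&: S :\: S') :|: (vertices F :\: S).
    apply/setP => i; rewrite in_setU !in_setD in_setI; case: (boolP (i \in S')) => /= iS'.
      by have := subsetP S'S _ iS'; rewrite in_setI => /andP[_ ->] /=.
    by case: (i \in vertices F); case: (i \in S).
  apply/tuplesP => i; rewrite ffunE in_setU.
  by have := tuplesP _ _ yS i; have := tuplesP _ _ zF i; case: (y i) => [a|] <- <-.
apply: le_trans (density_section R n1 X gF).
rewrite ler_pM2r ?invr_gt0 ?exprn_gt0 ?n_gt0 // ler_nat subset_leq_card //.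
apply/subsetP => x; rewrite !in_section => /and3P[-> _] /=.
by rewrite glueA.
Qed.

(** Fixing the coordinates outside [S] according to [z] turns a covering for [A] into one for the
    restricted pattern, at no greater cost by induction. *)
Lemma chi_restrict A S X z : edge_closed S (tree_edges A) ->
  X \in pathsets n (vertices (tree_edges A)) ->
  z \in tuples n (vertices (tree_edges A) :\: S) ->
  (chi R (restrict_tree S A) (section (vertices (tree_edges A) :&: S) X z)
    <= tree_chi R A X)%N.
Proof.
elim: A X z => [e|B IB C IC] X z cl XA zA.
  by rewrite /=; case: ifP => // _; apply: card_section_le.
have [[r [r1 r2] ->] _] := chi_node_min R n1 k2 XA.
have clB := edge_closedS (subsetUl _ _) cl; have clC := edge_closedS (subsetUr _ _) cl.
set EB := tree_edges B; set EC := tree_edges C.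
have zr V : V \subset vertices (EB :|: EC) -> restr V z \in tuples n (V :\: S).
  move=> /subsetP VA; apply/tuplesP => i; rewrite ffunE in_setD.
  case: (boolP (i \in V)) => [iV|]; last by rewrite andbF.
  by have := tuplesP _ _ zA i; rewrite in_setD (VA i iV).
have zB := zr _ (verticesS (subsetUl EB EC)); have zC := zr _ (verticesS (subsetUr EB EC)).
set zb := restr _ z in zB; set zc := restr _ z in zC.
set WB := vertices EB :&: S; set WC := vertices EC :&: S.
have sub : section (vertices (EB :|: EC) :&: S) X z \subset
    \bigcup_(p <- r) join WB WC (section WB p.1 zb) (section WC p.2 zc).
  apply/subsetP => y; rewrite in_section => /andP[yW gX].
  have /bigcup_seqP[p pr] := subsetP r2 _ gX; rewrite in_join => /and3P[_ gB gC].
  apply/bigcup_seqP; exists p => //.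
  have WE : vertices (EB :|: EC) :&: S = WB :|: WC by rewrite verticesU setIUl.
  rewrite in_join -WE yW /= !in_section.
  have aux V : V \subset vertices (EB :|: EC) ->
      restr V (glue y z) = glue (restr (V :&: S) y) (restr V z) /\
      restr (V :&: S) y \in tuples n (V :&: S).
    move=> VA; split; last by apply: restr_tuples yW; apply: setSI.
    rewrite restr_glue; congr glue; apply/ffunP => i; rewrite !ffunE in_setI.
    case: (i \in V) => //=; case: (boolP (i \in S)) => // iS.
    by rewrite (tuples_None yW) // in_setI negb_and iS orbT.
  have [eB ->] := aux _ (verticesS (subsetUl EB EC)).
  have [eC ->] := aux _ (verticesS (subsetUr EB EC)).
  by rewrite -eB -eC gB gC.
have empty D : restrict_tree S D = None -> edge_closed S (tree_edges D) ->
    vertices (tree_edges D) :&: S = set0.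
  by move=> nD cD; rewrite -vertices_restrict // -restrict_tree_edges nD /= vertices0.
have chiB p : p \in r -> (chi R (restrict_tree S B) (section WB p.1 zb) <= tree_chi R B p.1)%N.
  by move=> /r1[[pB _] _]; apply: IB.
have chiC p : p \in r -> (chi R (restrict_tree S C) (section WC p.2 zc) <= tree_chi R C p.2)%N.
  by move=> /r1[_ [pC _]]; apply: IC.
have eW : vertices (EB :|: EC) :&: S = WB :|: WC by rewrite verticesU setIUl.
have edB := restrict_tree_edges S B; have edC := restrict_tree_edges S C.
rewrite /= -/EB -/EC.
move: (empty B) (empty C) chiB chiC edB edC.
case: (restrict_tree S B) => [B'|] eB; case: (restrict_tree S C) => [C'|] eC chiB chiC edB edC //=.
- apply: (@leq_trans (\sum_(p <- [seq (section WB p.1 zb, section WC p.2 zc) | p <- r])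
      (tree_chi R B' p.1 + tree_chi R C' p.2))%N); last first.
    rewrite big_map big_seq [leqRHS]big_seq; apply: leq_sum => p pr.
    by apply: leq_add; [apply: chiB|apply: chiC].
  have vB : vertices (tree_edges B') = WB by rewrite [tree_edges B']edB vertices_restrict.
  have vC : vertices (tree_edges C') = WC by rewrite [tree_edges C']edC vertices_restrict.
  have XN : section (vertices (EB :|: EC) :&: S) X z \in
      pathsets n (vertices (tree_edges B' :|: tree_edges C')).
    by rewrite (verticesU (tree_edges B')) vB vC -eW section_pathset.
  have [_] := chi_node_min R n1 k2 XN; apply.
  split; last by rewrite big_map /= vB vC.
  move=> _ /mapP[p pr ->] /=; have [sB sC] := r1 p pr.
  rewrite [tree_edges B']edB [tree_edges C']edC.
  by split; apply: small_section.
(* All leaves of [C] are gone, so the joins lie in the sections for [B], and [tree_chi_cover]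
   applies. *)
- have WC0 : WC = set0 by apply: eC.
  have vB : vertices (tree_edges B') = WB by rewrite [tree_edges B']edB vertices_restrict.
  apply: (@leq_trans (\sum_(Y <- [seq section WB p.1 zb | p <- r]) tree_chi R B' Y)%N).
    apply: tree_chi_cover => //.
      by move=> _ /mapP[p pr ->]; rewrite vB section_pathset.
    rewrite big_map; apply: subset_trans sub _; apply/subsetP => y /bigcup_seqP[p pr].
    rewrite in_join WC0 setU0 => /and3P[yB + _]; rewrite (restr_id yB) // => yp.
    by apply/bigcup_seqP; exists p.
  rewrite big_map big_seq [leqRHS]big_seq; apply: leq_sum => p pr.
  exact: leq_trans (chiB _ pr) (leq_addr _ _).
- have WB0 : WB = set0 by apply: eB.
  have vC : vertices (tree_edges C') = WC by rewrite [tree_edges C']edC vertices_restrict.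
  apply: (@leq_trans (\sum_(Y <- [seq section WC p.2 zc | p <- r]) tree_chi R C' Y)%N).
    apply: tree_chi_cover => //.
      by move=> _ /mapP[p pr ->]; rewrite vC section_pathset.
    rewrite big_map; apply: subset_trans sub _; apply/subsetP => y /bigcup_seqP[p pr].
    rewrite in_join WB0 set0U => /and3P[yC _]; rewrite (restr_id yC) // => yp.
    by apply/bigcup_seqP; exists p.
  rewrite big_map big_seq [leqRHS]big_seq; apply: leq_sum => p pr.
  exact: leq_trans (chiC _ pr) (leq_addl _ _).
Qed.

End RestrictComplexity.

(** * Lower bounds at a node *)

Section LowerBounds.
Variables (R : realType) (k n : nat).
Hypotheses (n1 : (1 <= n)%N) (k2 : (2 <= k)%N).
Local Notation nt := (ntilde R n k).
Implicit Types (E F G : {set 'I_k}) (X Y : {set ptuple k n}).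
Implicit Types (A B C D : tree k) (L : seq (factor k n)).
Implicit Types (S V W : {set 'I_k.+1}) (x y z : ptuple k n).

(** The maximum in [mu] is attained at some [z]. The section there is a pathset for [B'], whose
    components are exactly those of [B] away from [E], and [chi_restrict] compares the costs. *)
Lemma mu_away_le_chi E B B' phi X :
  restrict_tree (cover (away (tree_edges B) E)) B = Some B' ->
  bounded n B' (phi + (ncomp (tree_edges B'))%:R) ->
  X \in pathsets n (vertices (tree_edges B)) ->
  nt `^ (phi + #|away (tree_edges B) E|%:R) *
    mu R (vertices (tree_edges B)) (cover (away (tree_edges B) E)) X <=
  (tree_chi R B X)%:R.
Proof.
set S := cover _ => eB' bB' XB.
have cl : edge_closed S (tree_edges B) by apply: cover_away_closed.
have [z zB ->] := mu_attained R n1 (vertices (tree_edges B)) S X.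
have SB : vertices (tree_edges B) :&: S = S by apply/setIidPr/cover_away_sub.
have edB' : tree_edges B' = restrict_edges S (tree_edges B).
  by rewrite -restrict_tree_edges eB'.
have vB' : vertices (tree_edges B') = S by rewrite edB' vertices_restrict // SB.
have := chi_restrict R n1 k2 cl XB zB; rewrite eB' SB /= -(ler_nat R).
apply: le_trans; rewrite -components_restrict_away -edB' -/(ncomp _) -{1}vB'.
by apply: bB'; rewrite vB' section_pathset.
Qed.

(** Both sides are joined to the one-point pathset of the empty graph, which has density 1. Every
    component of the union is hit on the way, for a factor [1/nt] each. *)
Lemma density_join2_small E F X Y : small R E X -> small R F Y ->
  density R (vertices (E :|: F)) (join (vertices E) (vertices F) X Y) <=
  nt `^ (- (ncomp (E :|: F))%:R).
Proof.
move=> smX smY.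
pose x0 : ptuple k n := [ffun=> None].
have T0 : [set x0] \in pathsets n (vertices (set0 : {set 'I_k})).
  by rewrite powersetE sub1set vertices0 tuples_set0.
pose L : seq (factor k n) := [:: (E, X); (F, Y)].
have eL : set0 :|: union_edges (unzip1 L) = E :|: F.
  by rewrite set0U /union_edges /= !big_cons big_nil setU0.
have smL p : p \in L -> small R p.1 p.2 by rewrite !inE => /orP[] /eqP ->.
have := density_bigjoin n1 k2 (subxx (components (E :|: F))) T0 smL.
rewrite eL => le0; have {le0} := le0 (subxx _).
rewrite hits0 cards0 hits_full // sub0r -/(ncomp _).
have -> : density R (vertices set0) [set x0] = 1.
  by rewrite /density cards1 vertices0 cards0 expr0 divr1.
rewrite mul1r; apply: le_trans.
rewrite ler_wpM2r ?invr_ge0 ?exprn_ge0 ?ler0n // ler_nat subset_leq_card //.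
apply/subsetP => x; rewrite in_join in_bigjoin eL verticesU /= => /and3P[-> -> ->].
by rewrite vertices0 restr_set0 inE eqxx.
Qed.

(* The density of a join is at most the product of the two costs, up to the
   normalization, and at most [nt ^ - c], since both sides are small.  The sum
   of the costs is at least their geometric mean, whence the half. *)
Lemma bounded_node B C D (E E' : tree k) s t (QQ : {set {set 'I_k.+1}}) (phi psi : R) :
  branch D B s -> branch E C t ->
  QQ \subset components (tree_edges (Node B C)) ->
  bounded n D (phi + (ncomp (tree_edges D))%:R) ->
  restrict_tree (cover (away (tree_edges E) (tree_edges D))) E = Some E' ->
  bounded n E' (psi + (ncomp (tree_edges E'))%:R) ->
  bounded n (Node B C)
    ((phi + psi + #|outer QQ (tree_edges D) set0|%:R
      + #|outer QQ (tree_edges E) (tree_edges D)|%:R + #|QQ|%:R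
      + (ncomp (tree_edges (Node B C)))%:R) / 2).
Proof.
move=> DB EC QN bD eE' bE' X XN.
set e2 := phi + psi + _ + _ + _.
set N := tree_edges (Node B C).
have eB := branch_edges DB; have eC := branch_edges EC.
have BN : tree_edges B \subset N by apply: subsetUl.
have CN : tree_edges C \subset N by apply: subsetUr.
have DN : tree_edges D \subset N by apply: subset_trans BN; rewrite eB subsetUl.
have EN : tree_edges E \subset N by apply: subset_trans CN; rewrite eC subsetUl.
have oD : #|outer QQ (tree_edges D) set0|%:R + #|hits QQ (tree_edges D)|%:R <=
    (ncomp (tree_edges D))%:R :> R.
  rewrite -natrD ler_nat.
  by have := card_outer_hits set0 DN QN; rewrite set0U away0 hits0 cards0 addn0.
have oE : #|outer QQ (tree_edges E) (tree_edges D)|%:R +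
    #|hits QQ (tree_edges D :|: tree_edges E)|%:R <=
    #|away (tree_edges E) (tree_edges D)|%:R + #|hits QQ (tree_edges D)|%:R :> R.
  by rewrite -!natrD ler_nat; apply: card_outer_hits QN.
have [[r [r1 r2] ->] _] := chi_node_min R n1 k2 XN.
apply: le_trans (ler_wpM2l (powR_ge0 _ _) (density_cover _ _ r2)) _.
rewrite mulr_sumr natr_sum big_seq [leRHS]big_seq; apply: ler_sum => p pr.
have [smB smC] := r1 p pr; have [pB pC] := (proj1 smB, proj1 smC).
set J := join _ _ _ _.
have le1 := density_join2_small smB smC; rewrite -/N -/J in le1.
have le2 : nt `^ e2 * density R (vertices N) J <=
    (tree_chi R B p.1)%:R * (tree_chi R C p.2)%:R.
  have [T [T1 T2 T3]] := branch_flattens R n1 k2 DB pB.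
  have [U [U1 U2 U3]] := branch_flattens R n1 k2 EC pC.
  apply: (@le_trans _ _ ((\sum_(a <- T) tree_chi R D a.1)%N%:R *
      (\sum_(b <- U) tree_chi R E b.1)%N%:R)); last first.
    by apply: ler_pM; rewrite ?ler0n ?ler_nat.
  (* [E] is joined to [D] before the siblings from both branches, so its components are measured
     against [D] alone. *)
  pose f (a b : {set ptuple k n} * seq (factor k n)) :=
    bigjoin (tree_edges D) a.1 ((tree_edges E, b.1) :: a.2 ++ b.2).
  have eN a b : a \in T -> b \in U ->
      tree_edges D :|: union_edges (unzip1 ((tree_edges E, b.1) :: a.2 ++ b.2)) = N.
    move=> /T1[_ a2 _] /U1[_ b2 _].
    rewrite /union_edges /= big_cons /unzip1 map_cat big_cat -!/unzip1 a2 b2 /=.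
    rewrite -!/(union_edges _) /N /= eB eC; apply/setP => i; rewrite !in_setU.
    by case: (i \in tree_edges D); case: (i \in tree_edges E); case: (i \in union_edges s).
  have cov : J \subset \bigcup_(a <- T) \bigcup_(b <- U) f a b.
    apply/subsetP => x; rewrite in_join -verticesU -/N => /and3P[xN xB xC].
    have /bigcup_seqP[a aT] := subsetP T2 _ xB.
    have /bigcup_seqP[b bU] := subsetP U2 _ xC.
    rewrite !in_bigjoin => /and3P[_ xE xb] /and3P[_ xD xa].
    apply/bigcup_seqP; exists a => //; apply/bigcup_seqP; exists b => //.
    have subB F : F \in tree_edges D :: s -> vertices F \subset vertices (tree_edges B).
      exact: branch_vertices_sub.
    have subC F : F \in tree_edges E :: t -> vertices F \subset vertices (tree_edges C).
      exact: branch_vertices_sub.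
    have [_ a2 _] := T1 a aT; have [_ b2 _] := U1 b bU.
    rewrite in_bigjoin (eN a b) // xN /= all_cat.
    rewrite restr_restr ?subB ?mem_head // in xD.
    rewrite restr_restr ?subC ?mem_head // in xE.
    rewrite xD xE /=; apply/andP; split; apply/allP => q qL.
      move/allP/(_ q qL): xa; rewrite restr_restr // subB // in_cons -a2.
      by rewrite [_ \in unzip1 _]map_f ?orbT.
    move/allP/(_ q qL): xb; rewrite restr_restr // subC // in_cons -b2.
    by rewrite [_ \in unzip1 _]map_f ?orbT.
  apply: le_trans (ler_wpM2l (powR_ge0 _ _) (density_cover _ _ cov)) _.
  rewrite natr_sum mulr_suml mulr_sumr big_seq [leRHS]big_seq.
  apply: ler_sum => a aT; rewrite natr_sum mulr_sumr.
  apply: le_trans (ler_wpM2l (powR_ge0 _ _) (density_cover _ _ (subxx _))) _.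
  rewrite mulr_sumr big_seq [leRHS]big_seq; apply: ler_sum => b bU.
  have [aD a2 asm] := T1 a aT; have [bE b2 bsm] := U1 b bU.
  set away_ := away (tree_edges E) (tree_edges D) in eE' oE *.
  have leJ : density R (vertices (tree_edges D :|: tree_edges E))
      (join (vertices (tree_edges D)) (vertices (tree_edges E)) a.1 b.1) <=
      density R (vertices (tree_edges D)) a.1 * mu R (vertices (tree_edges E)) (cover away_) b.1.
    by rewrite verticesU; apply: density_join; rewrite ?cover_away_sub ?cover_away_disjoint.
  have sm q : q \in a.2 ++ b.2 -> small R q.1 q.2.
    by rewrite mem_cat => /orP[/asm|/bsm].
  have jD : join (vertices (tree_edges D)) (vertices (tree_edges E)) a.1 b.1 \in
      pathsets n (vertices (tree_edges D :|: tree_edges E)) by rewrite verticesU join_pathset.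
  have := density_bigjoin n1 k2 QN jD sm.
  have eN' : tree_edges D :|: tree_edges E :|: union_edges (unzip1 (a.2 ++ b.2)) = N.
    by rewrite -(eN a b) // /union_edges /= big_cons setUA.
  rewrite eN' (hits_full QN) => le0; have {le0} le3 := le0 (subxx _).
  rewrite /f bigjoin_cons /=.
  apply: le_trans (ler_wpM2l (powR_ge0 _ _) le3) _.
  apply: le_trans (ler_wpM2l (powR_ge0 _ _) (ler_wpM2r (powR_ge0 _ _) leJ)) _.
  have leE := mu_away_le_chi eE' bE' bE; have leD := bD _ aD.
  apply: le_trans (ler_pM _ _ leD leE);
    rewrite ?mulr_ge0 ?powR_ge0 ?density_ge0 ?mu_ge0 ?invr_ge0 ?exprn_ge0 ?ler0n //.
  set dD := density _ _ _; set mE := mu _ _ _ _.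
  have -> : nt `^ (phi + (ncomp (tree_edges D))%:R) * dD *
      (nt `^ (psi + #|away_|%:R) * mE) =
      nt `^ (phi + (ncomp (tree_edges D))%:R + (psi + #|away_|%:R)) * (dD * mE).
    by rewrite [in RHS](ntilde_powRD k n1 (phi + _)); ring.
  rewrite [dD * mE * _]mulrC [leLHS]mulrA -ntilde_powRD //.
  apply: ler_wpM2r; first by rewrite mulr_ge0 ?density_ge0 ?mu_ge0.
  by apply: ntilde_powR_le => //; rewrite /e2; lra.
set b := (tree_chi R B p.1)%:R : R; set c := (tree_chi R C p.2)%:R : R.
rewrite natrD -/b -/c.
have [b0 c0] : 0 <= b /\ 0 <= c by rewrite !ler0n.
have d0 := density_ge0 R (vertices N) J.
set d := density _ _ _ in le1 le2 d0 *.
(* In the square, one factor [d] is absorbed with [nt ^ c] by [le1], where [c] is the number of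
   components; the other is bounded by [le2]. Finally [b * c <= (b + c) ^ 2]. *)
rewrite -ler_sqr ?nnegrE ?addr_ge0 //; last by rewrite mulr_ge0 ?powR_ge0.
apply: (@le_trans _ _ (b * c)); last by nra.
apply: le_trans le2.
rewrite exprMn -[X in X * _]powR_mulrn ?powR_ge0 // -powRrM divfK ?pnatr_eq0 //.
rewrite ntilde_powRD // -mulrA ler_wpM2l ?powR_ge0 // expr2 mulrA ler_piMl //.
apply: le_trans (ler_wpM2l (powR_ge0 _ _) le1) _.
by rewrite mulrC ntilde_powRN.
Qed.

Lemma card_vertices1 (e : 'I_k) : #|vertices [set e]| = 2.
Proof.
have -> : vertices [set e] = [set src e; dst e].
  apply/setP => v; rewrite in_set2; apply/verticesP/idP => [[f /set1P ->]//|ev].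
  by exists e; rewrite ?set11.
by rewrite cards2 -(inj_eq val_inj) /= /bump /= -[X in X != _]add0n eqn_add2r.
Qed.

Lemma ncomp1 (e : 'I_k) : ncomp [set e] = 1%N.
Proof.
have ee : e \in [set e] by rewrite set11.
apply/eqP/cards1P; exists (block [set e] (src e)); apply/setP => P; rewrite inE.
apply/idP/eqP => [PE|->]; last by rewrite block_components // src_vertices.
have [v vP] := components_nonempty PE.
suff : src e \in P by apply: components_block.
have := subsetP (components_sub_vertices PE) v vP.
case/verticesP => f /set1P -> /orP[] /eqP ev; rewrite -?ev //.
rewrite (components_block PE vP) in_block src_vertices // ev /= adj_connect_sym.
exact: connect1 (adj_edge ee).
Qed.

(** An edge has two vertices, so the density is [#|X| / n ^ 2], and [nt <= n]: the excess of a leaf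
    is 1. *)
Lemma bounded_leaf (e : 'I_k) : bounded n (Leaf e) (1 + (ncomp (tree_edges (Leaf e)))%:R : R).
Proof.
move=> X _; rewrite /= ncomp1 /density card_vertices1 -natr1 addrA.
rewrite (_ : 1 + 0 + 1 = 2%:R) ?powR_mulrn ?(ltW (ntilde_gt0 R k n1)) //; last by rewrite addr0.
rewrite mulrCA ler_piMr ?ler0n // ler_pdivrMr ?exprn_gt0 ?n_gt0 // mul1r.
by rewrite lerXn2r ?nnegrE ?ler0n ?(ltW (ntilde_gt0 R k n1)) ?ntilde_le.
Qed.

End LowerBounds.

(** * Subpatterns inside one half of an interval *)

Section Windows.
Variable k : nat.
Implicit Types (E F W KE : {set 'I_k}) (A B C D Z : tree k).

Lemma split_window A W : (1 < #|W|)%N -> W \subset tree_edges A ->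
  exists Z Z' s s', [/\ branch Z A s, branch Z' A s', tree_edges Z' \in s &
    [/\ W \subset tree_edges Z :|: tree_edges Z', ~~ (W \subset tree_edges Z),
      ~~ (W \subset tree_edges Z') & (#|W| <= 2 * #|tree_edges Z :&: W|)%N]].
Proof.
move=> W1; elim: A => [e|B IB C IC] WA.
  by have := subset_leq_card WA; rewrite cards1; lia.
case: (boolP (W \subset tree_edges B)) => [/IB|WB].
  move=> [Z [Z' [s [s' [ZB Z'B Zs cond]]]]].
  exists Z, Z', (tree_edges C :: s), (tree_edges C :: s').
  by split; rewrite ?in_cons ?Zs ?orbT //; apply: branch_left.
case: (boolP (W \subset tree_edges C)) => [/IC|WC].
  move=> [Z [Z' [s [s' [ZB Z'B Zs cond]]]]].
  exists Z, Z', (tree_edges B :: s), (tree_edges B :: s').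
  by split; rewrite ?in_cons ?Zs ?orbT //; apply: branch_right.
have bB := branch_left C (branch_refl B); have bC := branch_right B (branch_refl C).
have le : (#|W| <= #|tree_edges B :&: W| + #|tree_edges C :&: W|)%N.
  rewrite -{1}(setIidPr WA) /= setIUl; exact: leq_card_setU.
case: (leqP #|tree_edges C :&: W| #|tree_edges B :&: W|) => cmp.
  exists B, C, [:: tree_edges C], [:: tree_edges B].
  by split; rewrite ?mem_head //; split=> //; lia.
exists C, B, [:: tree_edges B], [:: tree_edges C].
by split; rewrite ?mem_head //; split; rewrite // 1?setUC //; lia.
Qed.

Lemma card_interval (a h : nat) : (h <= k)%N ->
  #|[set e : 'I_k | (a <= e < h)%N]| = (h - a)%N.
Proof.
elim: h => [|h IH] hk; first by apply: eq_card0 => e; rewrite inE andbF.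
case: (ltnP h a) => ha.
  rewrite (_ : h.+1 - a = 0)%N; last by lia.
  by apply: eq_card0 => e; rewrite inE; apply/negbTE/negP => /andP[]; lia.
have -> : [set e : 'I_k | (a <= e < h.+1)%N] =
    Ordinal hk |: [set e : 'I_k | (a <= e < h)%N].
  by apply/setP => e; rewrite !inE -(inj_eq val_inj) /=; lia.
by rewrite cardsU1 inE /= ltnn andbF IH ?subSn //; lia.
Qed.

Section Position.
(* The numbering of the edges is either [id] or [rev_ord]: the statements below
   are used at both ends of an interval. *)
Variable pos : 'I_k -> 'I_k.
Hypothesis pos_inj : injective pos.

Lemma pos_surj (i : nat) : (i < k)%N -> exists e, pos e = i :> nat.
Proof.
by move=> ik; exists (invF pos_inj (Ordinal ik)); rewrite f_invF.
Qed.

Definition window (a h : nat) := [set e : 'I_k | (a <= pos e < h)%N].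

Lemma card_window (a h : nat) : (h <= k)%N -> #|window a h| = (h - a)%N.
Proof.
move=> hk; rewrite -(card_interval a hk) -[RHS](card_preimset _ pos_inj).
by apply: eq_card => e; rewrite !inE.
Qed.

Variables (A : tree k) (KE : {set 'I_k}) (l : nat).
Hypothesis l_gt0 : (0 < l)%N.
Hypothesis KA : KE \subset tree_edges A.
Local Notation inK D := (tree_edges D :&: KE).
Hypothesis convex : forall D s, branch D A s -> (l <= 32 * #|inK D|)%N ->
  forall e f g, e \in inK D -> g \in inK D -> (pos e < pos f < pos g)%N -> f \in inK D.
(** If a heavy [D] lies wholly beyond [f] and the sibling [F] has an edge [u] before [f], the
    component of [u] in [F] must reach [D], hence cross [f]. *)
Hypothesis touch : forall D s F, branch D A s -> (l <= 32 * #|inK D|)%N -> F \in s ->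
  forall u f, u \in F :&: KE -> (pos u < pos f)%N ->
    (forall e, e \in inK D -> (pos f < pos e)%N) -> f \in F.

(* Take the deepest subpattern containing the window, and its child [Z] with more
   edges in the window.  If [Z] reaches the last edge [e0], then the first edge [u]
   is in the other child [Z'], and every heavy subpattern below [Z] must touch the
   component of [u] in [Z'].  So, in the deepest subpattern of [Z] containing
   the part of the window beyond that component, the larger child misses [e0]. *)
Lemma window_piece (a h : nat) : (h <= k)%N -> (3 * l + 8 <= 8 * (h - a))%N ->
  window a h \subset KE ->
  exists D s, [/\ branch D A s, (l <= 8 * #|inK D|)%N &
    forall e, e \in inK D -> ((pos e).+1 < h)%N].
Proof.
move=> hk lw WK.
have inW e : (e \in window a h) = (a <= pos e < h)%N by rewrite inE.
(* Missing the last edge [e0] will leave a gap between the pieces found in the two halves. *)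
have [e0 pe0] : exists e, pos e = h.-1 :> nat by apply: pos_surj; lia.
have ah : (a <= h.-1)%N by lia.
have h32 m : (l <= 8 * m)%N -> (l <= 32 * m)%N by clear; lia.
have [u pu] : exists e, pos e = a :> nat by apply: pos_surj; lia.
have uW : u \in window a h by rewrite inW pu; lia.
have e0W : e0 \in window a h by rewrite inW pe0; lia.
have posD e f : e != f -> pos e != pos f :> nat.
  by apply: contraNneq => /val_inj /pos_inj ->.
have conv' D s : branch D A s -> (l <= 32 * #|inK D|)%N ->
    forall e f g, e \in inK D -> g \in inK D -> (pos e <= pos f <= pos g)%N -> f \in inK D.
  move=> DA hD e f g eD gD efg.
  case: (eqVneq f e) => [-> //|/posD fe]; case: (eqVneq f g) => [-> //|/posD fg].
  by apply: (convex DA hD eD gD); lia.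
(* A heavy subpattern that meets the window and misses [e0] cannot extend beyond [e0], by convexity,
   and so is the required piece. *)
have key D s e : branch D A s -> (l <= 8 * #|inK D|)%N -> e \in inK D ->
    e \in window a h -> e0 \notin tree_edges D ->
    exists D s, [/\ branch D A s, (l <= 8 * #|inK D|)%N &
      forall e, e \in inK D -> ((pos e).+1 < h)%N].
  move=> DA hD eD eW e0D; exists D, s; split=> // g gD; rewrite ltnNge.
  apply: contra e0D => gh; suff : e0 \in inK D by rewrite in_setI => /andP[].
  apply: (conv' _ _ DA _ e e0 g) => //; first by lia.
  by move: eW; rewrite inW pe0; lia.
have subD D s (f g : 'I_k) (j : nat) : branch D A s -> (l <= 32 * #|inK D|)%N ->
    f \in inK D -> e0 \in inK D -> (pos f <= j)%N -> window j h \subset tree_edges D.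
  move=> DA hD fD e0D fj; apply/subsetP => e; rewrite inE => eh.
  suff : e \in inK D by rewrite in_setI => /andP[].
  by apply: (conv' _ _ DA hD f e e0) => //; rewrite pe0; lia.
have cW := card_window a hk.
have [||Z [Z' [s [s' [ZA Z'A Z's [WZ nZ nZ' cZ]]]]]] := @split_window A (window a h).
- by rewrite cW; lia.
- exact: subset_trans WK KA.
have IW D : (#|tree_edges D :&: window a h| <= #|inK D|)%N.
  by apply/subset_leq_card/setIS.
have pick D W : W \subset KE -> (0 < #|tree_edges D :&: W|)%N ->
    exists2 e, e \in inK D & e \in W.
  move=> WK'; rewrite card_gt0 => /set0Pn[e /setIP[eD eW]].
  by exists e; rewrite // in_setI eD (subsetP WK').
have hZ8 : (l <= 8 * #|inK Z|)%N by have := IW Z; rewrite cW in cZ; lia.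
have hZ := h32 _ hZ8.
have [|z0 z0Z z0W] := pick Z _ WK; first by rewrite cW in cZ; lia.
case: (boolP (e0 \in tree_edges Z)) => e0Z; last exact: key ZA hZ8 z0Z z0W e0Z.
have e0Zk : e0 \in inK Z by rewrite in_setI e0Z (subsetP WK).
(* With both ends, [Z] would contain the whole window by convexity. *)
have uZ : u \notin tree_edges Z.
  apply: contra nZ => uZ; apply: (subD Z s u u a ZA hZ) => //; last by rewrite pu.
  by rewrite in_setI uZ (subsetP WK).
have uZ' : u \in tree_edges Z'.
  by have := subsetP WZ _ uW; rewrite in_setU (negbTE uZ).
have uZ'k : u \in inK Z' by rewrite in_setI uZ' (subsetP WK).
have ltZ e : e \in inK Z -> (pos u < pos e)%N.
  move=> eZ; rewrite ltnNge; apply: contra uZ => eu.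
  suff : u \in inK Z by rewrite in_setI => /andP[].
  have le : (pos e <= pos u <= pos e0)%N by rewrite eu pe0 pu.
  exact: (conv' Z s ZA hZ e u e0 eZ e0Zk le).
(* If [Z'] is heavy too, it contains [u], hence not [e0], and is the piece. *)
case: (leqP l (8 * #|inK Z'|)) => hZ'.
  case: (boolP (e0 \in tree_edges Z')) => e0Z'; last exact: key Z'A hZ' uZ'k uW e0Z'.
  have e0Z'k : e0 \in inK Z' by rewrite in_setI e0Z' (subsetP WK).
  case/negP: nZ'; apply: (subD Z' s' u u a Z'A) => //; first exact: h32.
  by rewrite pu.
(* More than [l / 8] edges: [Z'] cannot contain the first [q] edges of the window. *)
pose q := (l %/ 8).+1.
have [f fW fZ'] : exists2 f, f \in window a (a + q) & f \notin tree_edges Z'.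
  apply/subsetPn; apply: contraL hZ' => sub; rewrite -leqNgt.
  have : (#|window a (a + q)| <= #|inK Z'|)%N.
    apply: subset_leq_card; rewrite subsetI sub; apply: subset_trans WK.
    apply/subsetP => e; rewrite !inE /q; move: lw; clear; lia.
  by rewrite card_window /q; move: lw hk; clear; lia.
have fa : (a <= pos f < a + q)%N by move: fW; rewrite inE.
have uf : (pos u < pos f)%N.
  have : u != f by apply: contraNneq fZ' => <-.
  by move=> /posD; rewrite pu; move: fa; clear; lia.
(* Below [Z], the pattern [Z'] remains a sibling, so heavy subpatterns there have an edge at or
   before [f]. *)
have tch D t : branch D A t -> (l <= 32 * #|inK D|)%N -> tree_edges Z' \in t ->
    exists2 z, z \in inK D & (pos z <= pos f)%N.
  move=> DA hD Z't; apply: contrapT => no; case/negP: fZ'.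
  apply: (touch DA hD Z't uZ'k uf) => e eD; rewrite ltnNge; apply/negP => le.
  by apply: no; exists e.
have [z zZ zf] := tch Z s ZA hZ Z's.
have W'Z := subD Z s z z (pos f) ZA hZ zZ e0Zk zf.
have W'W : window (pos f) h \subset window a h.
  by apply/subsetP => e; rewrite !inE; move: fa; clear; lia.
have cW' := card_window (pos f) hk.
(* At most [l / 8] edges precede [f] in a window of at least [3 * l / 8 + 1], so more than [l / 4]
   remain and [X] keeps at least [l / 8] of them. *)
have [|X [_ [t [_ [XZ _ _ [_ nX _ cX]]]]]] := split_window _ W'Z.
  by rewrite cW'; move: fa lw l_gt0; rewrite /q; clear; lia.
have XA := branch_trans XZ ZA.
have IW' : (#|tree_edges X :&: window (pos f) h| <= #|inK X|)%N.
  by apply/subset_leq_card/setIS/(subset_trans W'W).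
have hX : (l <= 8 * #|inK X|)%N by move: fa cX IW' lw; rewrite cW' /q; clear; lia.
have [|x xX xW'] := pick X _ (subset_trans W'W WK).
  by move: fa cX lw l_gt0; rewrite cW' /q; clear; lia.
apply: (key X _ x XA hX xX); first exact: (subsetP W'W).
(* [X] reaches back to [f]; if it also contained [e0], it would contain the whole remaining
   window. *)
have hX32 := h32 _ hX.
have [|y yX yf] := tch X _ XA hX32; first by rewrite mem_cat Z's.
apply: contra nX => e0X; apply: (subD X _ y y _ XA hX32) => //.
by rewrite in_setI e0X (subsetP WK).
Qed.

End Position.

(** The two branches are followed down from [A] until one of them ends or they part. *)
Lemma branch_common A D (E : tree k) s t : branch D A s -> branch E A t ->
  [\/ tree_edges D \subset tree_edges E, tree_edges E \subset tree_edges D |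
    exists B C r s' t', branch (Node B C) A r /\
      (branch D B s' /\ branch E C t' \/ branch E B t' /\ branch D C s')].
Proof.
move=> DA; elim: DA t => [|B C s' DB IH|B C s' DC IH] t EA.
- by apply: Or32; rewrite (branch_edges EA) subsetUl.
- have DN := branch_edges (branch_left C DB).
  move: EA => EA; inversion EA as [|B1 C1 t' EB|B1 C1 t' EC]; subst.
  + by apply: Or31; rewrite DN subsetUl.
  + case: (IH _ EB) => [h|h|[B' [C' [r [s1 [t1 [NB h]]]]]]]; [exact: Or31|exact: Or32|].
    apply: Or33; exists B', C', (tree_edges C :: r), s1, t1.
    by split=> //; apply: branch_left.
  + apply: Or33; exists B, C, [::], s', t'; split; first exact: branch_refl.
    by left.
- have DN := branch_edges (branch_right B DC).
  move: EA => EA; inversion EA as [|B1 C1 t' EB|B1 C1 t' EC]; subst.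
  + by apply: Or31; rewrite DN subsetUl.
  + apply: Or33; exists B, C, [::], s', t'; split; first exact: branch_refl.
    by right.
  + case: (IH _ EC) => [h|h|[B' [C' [r [s1 [t1 [NB h]]]]]]]; [exact: Or31|exact: Or32|].
    apply: Or33; exists B', C', (tree_edges B :: r), s1, t1.
    by split=> //; apply: branch_right.
Qed.

End Windows.

(** * The induction *)

Section Lg.
Variable R : realType.

(** A real-valued [log2], sufficient because a nonempty pattern has a component with an edge. *)
Definition lg (m : nat) : R := ln m%:R / ln 2.

Lemma ln2_gt0 : 0 < ln (2 : R).
Proof. by rewrite ln_gt0 // ltr1n. Qed.

Lemma lg_le (l j M : nat) : (0 < l)%N -> (l <= 2 ^ j * M)%N -> lg l <= j%:R + lg M.
Proof.
move=> l0 le; have M0 : (0 < M)%N by case: M le; lia.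
rewrite /lg ler_pdivrMr ?ln2_gt0 // mulrDl divfK ?gt_eqF ?ln2_gt0 //.
rewrite mulr_natl -lnXn ?ltr0n // -lnM ?posrE ?exprn_gt0 ?ltr0n //.
by rewrite ler_ln ?posrE ?mulr_gt0 ?exprn_gt0 ?ltr0n // -natrX -natrM ler_nat.
Qed.

Lemma lg1 : lg 1 = 0.
Proof. by rewrite /lg ln1 mul0r. Qed.

End Lg.

(** * Components as intervals of edges *)

Section Interval.
Variable k : nat.
Implicit Types (E F : {set 'I_k}) (K P : {set 'I_k.+1}).

Lemma connect_run E (u v : 'I_k.+1) : (u <= v)%N ->
  (forall j : 'I_k, (u <= j < v)%N -> j \in E) -> connect (adj E) u v.
Proof.
move: {2}(v - u)%N (erefl (v - u)%N) => d; elim: d v => [|d IH] v vu uv run.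
  by rewrite (_ : u = v) ?connect0 //; apply: val_inj => /=; lia.
have vk : (v.-1 < k)%N by have := ltn_ord v; lia.
pose j := Ordinal vk.
have dj : dst j = v by apply: val_inj; rewrite /= /bump /=; lia.
have jE : j \in E by apply: run; rewrite /=; lia.
rewrite -dj; apply: connect_trans (connect1 (adj_edge jE)).
apply: IH => [||i ij]; rewrite /= ?dj; try lia.
by apply: run; move: ij; rewrite /=; lia.
Qed.

Lemma component_edge E K e v : K \in components E -> e \in E ->
  (v == src e) || (v == dst e) -> v \in K -> e \in edges_in E K.
Proof.
move=> KE eE ev vK; apply/setIdP; split=> //.
have c := connect1 (adj_edge eE).
rewrite !(components_block KE vK) !in_block src_vertices ?dst_vertices //=.
by case/orP: ev => /eqP ->; rewrite ?connect0 ?c // adj_connect_sym c.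
Qed.

Lemma component_convex E P (e g f : 'I_k) : P \in components E ->
  e \in edges_in E P -> g \in edges_in E P -> (e < f < g)%N -> f \in E.
Proof.
move=> PE /setIdP[eE /andP[eP _]] /setIdP[gE /andP[_ gP]] efg.
apply: (@connect_crosses _ _ (src e) (dst g)).
  by have := gP; rewrite (components_block PE eP) in_block => /andP[].
by rewrite /= /bump /=; lia.
Qed.

Lemma edges_in_convex E K (e g f : 'I_k) : K \in components E ->
  e \in edges_in E K -> g \in edges_in E K -> (e < f < g)%N -> f \in edges_in E K.
Proof.
move=> KE eK gK efg.
have run (j : 'I_k) : (e < j < g)%N -> j \in E by apply: component_convex eK gK.
have /setIdP[eE /andP[_ eP]] := eK.
apply: (@component_edge E K f (src f) KE (run f efg)); first by rewrite eqxx.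
rewrite (components_block KE eP) in_block src_vertices ?run //=.
by apply: connect_run => [|j]; rewrite /= /bump /= => *; [lia|apply: run; lia].
Qed.

Lemma edges_in_interval E K : K \in components E -> (0 < #|edges_in E K|)%N ->
  exists2 a : nat, (a + #|edges_in E K| <= k)%N &
    forall e : 'I_k, (e \in edges_in E K) = (a <= e < a + #|edges_in E K|)%N.
Proof.
move=> KE /card_gt0P[e0 e0K].
pose a := [arg min_(i < e0 in edges_in E K) (i : nat)].
pose b := [arg max_(i > e0 in edges_in E K) (i : nat)].
have [aK amin] : a \in edges_in E K /\ forall e, e \in edges_in E K -> (a <= e)%N.
  by rewrite /a; case: arg_minnP.
have [bK bmax] : b \in edges_in E K /\ forall e, e \in edges_in E K -> (e <= b)%N.
  by rewrite /b; case: arg_maxnP.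
have eK : edges_in E K = [set e : 'I_k | (a <= e < b.+1)%N].
  apply/setP => e; rewrite [RHS]inE; apply/idP/idP => [eK|]; first by rewrite amin // ltnS bmax.
  move=> /andP[ae eb]; case: (eqVneq a e) => [<- //|ane]; case: (eqVneq e b) => [-> //|enb].
  apply: edges_in_convex aK bK _ => //; rewrite -(inj_eq val_inj) /= in ane.
  by rewrite -(inj_eq val_inj) /= in enb; lia.
have ab := amin _ bK.
have card : #|edges_in E K| = (b.+1 - a)%N by rewrite {1}eK card_interval.
exists a; first by rewrite card; have := ltn_ord b; lia.
by move=> e; rewrite card {1}eK inE; congr (_ && _); congr (_ < _)%N; lia.
Qed.

End Interval.

Lemma branch_size k (D A : tree k) s :
  branch D A s -> (D = A /\ s = [::]) \/ (tree_size D < tree_size A)%N.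
Proof.
elim=> [|B C s' _ IH|B C s' _ IH]; first by left.
  by right=> /=; case: IH => [[<- _]|]; lia.
by right=> /=; case: IH => [[<- _]|]; lia.
Qed.

Lemma branch_to_leaf k (A : tree k) : exists e s, branch (Leaf e) A s.
Proof.
elim: A => [e|B [e [s Be]] C _]; first by exists e, [::]; apply: branch_refl.
by exists e, (tree_edges C :: s); apply: branch_left.
Qed.

Lemma edges_in_le_maxlen k (E : {set 'I_k}) P :
  P \in components E -> (#|edges_in E P| <= maxlen E)%N.
Proof.
exact: (@leq_bigmax_cond _ (mem (components E)) (fun K => #|edges_in E K|)).
Qed.

Lemma maxlen_gt0 k (A : tree k) : (0 < maxlen (tree_edges A))%N.
Proof.
have [e [s /branch_edges eA]] := branch_to_leaf A.
have eE : e \in tree_edges A by rewrite eA /= !inE eqxx.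
have vA := src_vertices eE; have bA := block_components vA.
apply: leq_trans (edges_in_le_maxlen bA); apply/card_gt0P; exists e.
by apply: (component_edge bA eE _ (mem_block vA)); rewrite eqxx.
Qed.

Section Main.
Variables (R : realType) (k n : nat).
Hypotheses (n1 : (1 <= n)%N) (k2 : (2 <= k)%N).
Implicit Types (A B C D : tree k) (E F : {set 'I_k}).

Definition lower_bound A : Prop :=
  bounded n A (lg R (maxlen (tree_edges A)) / 6 + (ncomp (tree_edges A))%:R).

Lemma maxlen_attained A : exists2 K, K \in components (tree_edges A) &
  maxlen (tree_edges A) = #|edges_in (tree_edges A) K|.
Proof.
have [|K KA eK] := @eq_bigmax_cond _ (mem (components (tree_edges A)))
  (fun K => #|edges_in (tree_edges A) K|); last by exists K; rewrite // -eK.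
apply: contraTT (maxlen_gt0 A); rewrite -leqNgt leqn0 cards_eq0 => /eqP c0.
by rewrite /maxlen c0 big_set0.
Qed.

(** * The induction step, by contradiction, for a longest component [K] *)

Section Step.
Variable A : tree k.
Hypothesis IH : forall B, (tree_size B < tree_size A)%N -> lower_bound B.
Variable K : {set 'I_k.+1}.
Hypothesis KA : K \in components (tree_edges A).
Let KE := edges_in (tree_edges A) K.
Let QQ := components (tree_edges A) :\ K.
Hypothesis lK : maxlen (tree_edges A) = #|KE|.
Hypothesis l_gt0 : (0 < #|KE|)%N.
Local Notation l := #|KE|.
Local Notation inK D := (tree_edges D :&: KE).
Hypothesis lose : ~ lower_bound A.

Let QA : QQ \subset components (tree_edges A).
Proof. exact: subsetDl. Qed.

Let cQ : (#|QQ| + 1)%N = ncomp (tree_edges A).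
Proof. by rewrite /ncomp [RHS](cardsD1 K) KA addnC. Qed.

(** A component of [F] lies in exactly one component of [A], so it avoids all members of [QQ] only
    by lying in [K]. *)
Lemma outer_in_K F E P : F \subset tree_edges A ->
  (P \in outer QQ F E) = (P \in away F E) && (P \subset K).
Proof.
move=> FA; rewrite in_outer; case: (boolP (P \in away F E)) => //= PA.
have PF : P \in components F by move: PA; rewrite in_away => /andP[].
have [v vP] := components_nonempty PF.
apply/forallP/idP => [h|PK Q].
  have vA : v \in vertices (tree_edges A).
    by apply: (subsetP (verticesS FA)); apply: (subsetP (components_sub_vertices PF)).
  have bA := block_components vA.
  have Pb := components_refine FA PF bA vP (mem_block vA).
  have := h (block (tree_edges A) v); rewrite Pb implybF in_setD1 bA andbT negbK.
  by move=> /eqP <-.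
apply/implyP; rewrite in_setD1 => /andP[QK QA']; apply: contra QK => PQ.
by apply/eqP; apply: (components_eq QA' KA) (subsetP PQ _ vP) (subsetP PK _ vP).
Qed.

Lemma inK_component D s e : branch D A s -> e \in inK D ->
  exists2 P, P \in outer QQ (tree_edges D) set0 & e \in edges_in (tree_edges D) P.
Proof.
move=> DA /setIP[eD /setIdP[eA /andP[eK _]]].
have DsubA : tree_edges D \subset tree_edges A by rewrite (branch_edges DA) subsetUl.
have vD := src_vertices eD; have bD := block_components vD.
exists (block (tree_edges D) (src e)).
  rewrite outer_in_K // away0 bD /=.
  exact: components_refine DsubA bD KA (mem_block vD) eK.
by apply: (component_edge bD eD _ (mem_block vD)); rewrite eqxx.
Qed.

Lemma card_inK D s : branch D A s ->
  (#|inK D| <= #|outer QQ (tree_edges D) set0| * maxlen (tree_edges D))%N.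
Proof.
move=> DA; set X := outer _ _ _.
have sub : inK D \subset \bigcup_(P <- enum X) edges_in (tree_edges D) P.
  apply/subsetP => e /(inK_component DA)[P PX eP].
  by apply/bigcup_seqP; exists P; rewrite // mem_enum.
apply: leq_trans (subset_leq_card sub) (leq_trans (card_bigcup_le _ _) _).
rewrite big_enum /= -sum_nat_const; apply: leq_sum => P.
rewrite in_outer away0 => /andP[PD _]; exact: edges_in_le_maxlen.
Qed.

(* Induction applies to [D], and an excess [m + q - 1 >= 1] compensates the loss
   of a factor [32 * m] in the length of a longest component. *)
Lemma heavy_light D s q : branch D A s -> (tree_size D < tree_size A)%N ->
  (l <= 32 * #|inK D|)%N ->
  q = 0%N \/ (exists2 F, F \in s & q = #|outer QQ F (tree_edges D)|) ->
  (#|outer QQ (tree_edges D) set0| + q < 2)%N.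
Proof.
move=> DA sD hD hq; rewrite ltnNge; apply/negP => two; apply: lose.
have := bounded_branch n1 k2 DA QA hq (IH sD); apply: bounded_le => //.
have := card_inK DA; set m := #|outer _ _ _| in two *; set M := maxlen _ => cD.
have m0 : (0 < m)%N by case: (m) cD => //; lia.
(* By [m <= 2 ^ (m - 1)]. The loss in the exponent is then at most [(m + 4) / 6], which is at most
   [m + q - 1] once [m + q >= 2]. *)
have lm : (l <= 2 ^ (m + 4) * M)%N.
  have mm : (m <= 2 ^ m.-1)%N by rewrite -{1}(prednK m0); apply: ltn_expl.
  apply: (@leq_trans (32 * (m * M))%N); first lia.
  apply: (@leq_trans (32 * (2 ^ m.-1 * M))%N); first by rewrite leq_mul2l leq_mul2r mm orbT.
  have -> : (2 ^ (m + 4) = 2 ^ m.-1 * 32)%N.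
    by rewrite (_ : m + 4 = m.-1 + 5)%N ?expnD //; move: m0; clear; lia.
  by rewrite mulnA [(32 * _)%N]mulnC.
have := lg_le R l_gt0 lm; rewrite lK natrD -/M => lgl.
have : (#|QQ|%:R + 1 = (ncomp (tree_edges A))%:R :> R) by rewrite -cQ natrD.
have : 2 <= m%:R + q%:R :> R by rewrite -natrD ler_nat.
have q0 := ler0n R q.
lra.
Qed.

Lemma inK_one_component D s : branch D A s -> (l <= 32 * #|inK D|)%N ->
  exists2 P, outer QQ (tree_edges D) set0 = [set P] &
    forall e, e \in inK D -> e \in edges_in (tree_edges D) P.
Proof.
move=> DA hD; have [e eD] : exists e, e \in inK D by apply/card_gt0P; lia.
have [P PX eP] := inK_component DA eD.
suff X1 : outer QQ (tree_edges D) set0 = [set P].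
  exists P => // f /(inK_component DA)[Q]; by rewrite X1 => /set1P ->.
(* [heavy_light] excludes [D = A]; there [K] is the only component inside [K]. *)
case: (branch_size DA) => [[DA' _]|sD].
  apply/setP => Q; rewrite inE.
  have oK Q' : Q' \in outer QQ (tree_edges D) set0 -> Q' = K.
    rewrite DA' outer_in_K // away0 => /andP[Q'A Q'K].
    have [v vQ] := components_nonempty Q'A.
    exact: components_eq Q'A KA vQ (subsetP Q'K _ vQ).
  by apply/idP/eqP => [/oK ->|->//]; rewrite (oK _ PX).
have := heavy_light DA sD hD (or_introl erefl); rewrite addn0 => X2.
by apply/eqP; rewrite eq_sym eqEcard sub1set PX cards1 -ltnS.
Qed.

Lemma inK_convex D s : branch D A s -> (l <= 32 * #|inK D|)%N ->
  forall e f g : 'I_k, e \in inK D -> g \in inK D -> (e < f < g)%N -> f \in inK D.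
Proof.
move=> DA hD e f g eD gD efg; have [P X1 h] := inK_one_component DA hD.
have PD : P \in components (tree_edges D).
  by have := set11 P; rewrite -X1 in_outer away0 => /andP[].
rewrite in_setI (component_convex PD (h e eD) (h g gD)) //=.
by move: eD gD => /setIP[_ eK] /setIP[_ gK]; apply: edges_in_convex eK gK efg.
Qed.

Lemma vertex_inK D s v : branch D A s -> v \in vertices (tree_edges D) -> v \in K ->
  exists2 e, e \in inK D & (v == src e) || (v == dst e).
Proof.
move=> DA /verticesP[e eD ev] vK; exists e => //; rewrite in_setI eD.
by apply: component_edge ev vK => //; rewrite (branch_edges DA) in_setU eD.
Qed.

(** As [D] has one component in [K], [heavy_light] leaves [q = 0]: no component of [F] inside [K] is
    away from [D], in particular not that of [u]. *)
Lemma sibling_touches D s F u : branch D A s -> (l <= 32 * #|inK D|)%N ->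
  F \in s -> u \in F :&: KE -> exists e v,
  [/\ e \in inK D, (v == src e) || (v == dst e) & connect (adj F) (src u) v].
Proof.
move=> DA hD Fs /setIP[uF /setIdP[uA /andP[uK _]]].
have FA : F \subset tree_edges A.
  rewrite (branch_edges DA); apply: subset_trans (subsetUr _ _).
  by apply/subsetP => e eF; apply/bigcup_seqP; exists F.
have sD : (tree_size D < tree_size A)%N.
  by case: (branch_size DA) => // -[_ s0]; rewrite s0 in Fs.
have := heavy_light DA sD hD (or_intror (ex_intro2 _ _ F Fs erefl)).
have [P -> _] := inK_one_component DA hD.
rewrite cards1 add1n !ltnS leqn0 cards_eq0 => /eqP no.
have vF := src_vertices uF; have bF := block_components vF.
have bK := components_refine FA bF KA (mem_block vF) uK.
have : block F (src u) \notin outer QQ F (tree_edges D) by rewrite no inE.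
rewrite outer_in_K // bK andbT in_away bF /= => /pred0Pn[v /andP[/= vb vD]].
have [e eD ev] := vertex_inK DA vD (subsetP bK _ vb).
by exists e, v; split=> //; move: vb; rewrite in_block => /andP[].
Qed.

Lemma separated_false B C D (E : tree k) r s t :
  branch (Node B C) A r -> branch D B s -> branch E C t ->
  (l <= 8 * #|inK D|)%N -> (l <= 8 * #|inK E|)%N ->
  (forall e f : 'I_k, e \in inK D -> f \in inK E -> (e.+1 < f)%N || (f.+1 < e)%N) -> False.
Proof.
move=> NA DB EC lD lE sep; apply: lose.
have DN := branch_trans DB (branch_left C (branch_refl B)).
have EN := branch_trans EC (branch_right B (branch_refl C)).
have DA := branch_trans DN NA; have EA := branch_trans EN NA.
set N := Node B C in NA DN EN DA EA.
have sN : (tree_size N <= tree_size A)%N.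
  by case: (branch_size NA) => [[-> _]//|/ltnW].
have sD : (tree_size D < tree_size A)%N.
  by case: (branch_size DB) => [[-> _]|sDB]; apply: leq_trans sN; rewrite /=; lia.
have sE : (tree_size E < tree_size A)%N.
  by case: (branch_size EC) => [[-> _]|sEC]; apply: leq_trans sN; rewrite /=; lia.
have DsubN : tree_edges D \subset tree_edges N by rewrite (branch_edges DN) subsetUl.
have EsubN : tree_edges E \subset tree_edges N by rewrite (branch_edges EN) subsetUl.
have NsubA : tree_edges N \subset tree_edges A by rewrite (branch_edges NA) subsetUl.
have hD : (l <= 32 * #|inK D|)%N by move: lD; clear; lia.
have hE : (l <= 32 * #|inK E|)%N by move: lE; clear; lia.
have hN : (l <= 32 * #|inK N|)%N.
  by apply: leq_trans hD _; rewrite leq_mul2l subset_leq_card ?orbT // setSI.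
have [PN XN _] := inK_one_component NA hN.
have [PD XD inD] := inK_one_component DA hD.
have [PE XE inE_] := inK_one_component EA hE.
(* Exactly one component of [N] lies in [K]; [QN] collects the others. *)
pose QN := components (tree_edges N) :\: outer QQ (tree_edges N) set0.
have QNsub : QN \subset components (tree_edges N) by apply: subsetDl.
have cN : (#|QN| + 1)%N = ncomp (tree_edges N).
  rewrite /QN cardsD (setIidPr _).
    rewrite XN cards1 subnK // card_gt0; apply/set0Pn; exists PN.
    by have := set11 PN; rewrite -XN in_outer away0 => /andP[].
  by apply/subsetP => P; rewrite in_outer away0 => /andP[].
have outN F E' P : F \subset tree_edges N -> P \in away F E' -> P \subset K ->
    P \in outer QN F E'.
  move=> FN PA PK; rewrite in_outer PA /=; apply/forallP => Q; apply/implyP => /setDP[QN' Qo].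
  apply: contra Qo => PQ; rewrite outer_in_K // away0 QN' /=.
  have PF : P \in components F by move: PA; rewrite in_away => /andP[].
  have [v vP] := components_nonempty PF.
  exact: components_refine NsubA QN' KA (subsetP PQ _ vP) (subsetP PK _ vP).
have [PDc PDK] : PD \in components (tree_edges D) /\ PD \subset K.
  have := set11 PD; rewrite -XD outer_in_K ?away0; first by move=> /andP[].
  exact: subset_trans NsubA.
have [PEc PEK] : PE \in components (tree_edges E) /\ PE \subset K.
  have := set11 PE; rewrite -XE outer_in_K ?away0; first by move=> /andP[].
  exact: subset_trans NsubA.
have oD : (0 < #|outer QN (tree_edges D) set0|)%N.
  by apply/card_gt0P; exists PD; apply: outN; rewrite ?away0.
have PEaway : PE \in away (tree_edges E) (tree_edges D).
  (* Edges sharing a vertex are at most one position apart, against [sep]. *)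
  rewrite in_away PEc; apply/pred0P => v /=; apply/negP => /andP[vP vD].
  have vK := subsetP PEK _ vP; have vE := subsetP (components_sub_vertices PEc) _ vP.
  have [e eD ev] := vertex_inK DA vD vK; have [f fE fv] := vertex_inK EA vE vK.
  have := sep e f eD fE.
  by case/orP: ev => /eqP ev; move: fv; rewrite ev => /orP[] /eqP/(congr1 val) /=;
    rewrite /bump /=; clear; lia.
have oE : (0 < #|outer QN (tree_edges E) (tree_edges D)|)%N.
  by apply/card_gt0P; exists PE; apply: outN.
set S := cover (away (tree_edges E) (tree_edges D)).
have [f fE] : exists f, f \in inK E by apply/card_gt0P; move: hE l_gt0; clear; lia.
have inS g : g \in inK E -> g \in restrict_edges S (tree_edges E).
  move=> gE; have /setIdP[gE' /andP[gP _]] := inE_ g gE.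
  by apply/setIdP; split=> //; apply/bigcupP; exists PE.
have edE := restrict_tree_edges S E.
case eE' : (restrict_tree S E) edE => [E'|] /= edE; last first.
  by have := inS f fE; rewrite -edE inE.
have sE' := leq_ltn_trans (restrict_tree_size eE') sE.
have bN := bounded_node n1 k2 DB EC QNsub (IH sD) eE' (IH sE').
(* With all components of [A] as [QQ], the excess at [N] passes to [A] without loss. *)
have bA := @bounded_branch R k n n1 k2 N A r _ 0 (lg R l / 6) NA
  (subxx (components (tree_edges A))) (or_introl erefl).
suff le : lg R l / 6 + (ncomp (tree_edges N))%:R <=
    (lg R (maxlen (tree_edges D)) / 6 + lg R (maxlen (tree_edges E')) / 6 +
     #|outer QN (tree_edges D) set0|%:R + #|outer QN (tree_edges E) (tree_edges D)|%:R +
     #|QN|%:R + (ncomp (tree_edges N))%:R) / 2.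
  have := bA (bounded_le n1 k2 le bN); apply: bounded_le => //.
  rewrite lK -/(ncomp _); have := ler0n R #|outer (components (tree_edges A)) (tree_edges N) set0|.
  lra.
(* The [l / 8] edges of [D] lie in a single component, so each of the two logarithms loses at most
   3, and the two losses total [6 / 6 = 1]. *)
have lD' : (l <= 2 ^ 3 * maxlen (tree_edges D))%N.
  apply: leq_trans lD _; rewrite leq_mul2l /=; apply: leq_trans (edges_in_le_maxlen PDc).
  by apply/subset_leq_card/subsetP.
have lE' : (l <= 2 ^ 3 * maxlen (tree_edges E'))%N.
  apply: leq_trans lE _; rewrite leq_mul2l /=.
  have PE' : PE \in components (tree_edges E') by rewrite edE components_restrict_away.
  apply: leq_trans (edges_in_le_maxlen PE'); apply/subset_leq_card/subsetP => g gE.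
  have /setIdP[_ gP] := inE_ g gE; apply/setIdP; split=> //.
  by rewrite edE inS.
have := lg_le R l_gt0 lD'; have := lg_le R l_gt0 lE'.
have : 1 <= #|outer QN (tree_edges D) set0|%:R :> R by rewrite ler1n.
have : 1 <= #|outer QN (tree_edges E) (tree_edges D)|%:R :> R by rewrite ler1n.
have : #|QN|%:R + 1 = (ncomp (tree_edges N))%:R :> R by rewrite -cN natrD.
lra.
Qed.

Lemma long_component_false : (64 < l)%N -> False.
Proof.
move=> l64; have [a ak inKE] := edges_in_interval KA l_gt0.
have KEA : KE \subset tree_edges A by apply/subsetP => e /setIdP[].
pose h := (a + l %/ 2)%N.
have [D [s [DA lD Dh]]] : exists D s, [/\ branch D A s, (l <= 8 * #|inK D|)%N &
    forall e, e \in inK D -> ((id e).+1 < h)%N].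
  apply: (@window_piece k id _ A KE l l_gt0 KEA _ _ a h) => //.
  - exact: inK_convex.
  - move=> D s F DA hD Fs u f uF uf Df.
    have [e [v [eD ev uv]]] := sibling_touches DA hD Fs uF.
    (* The connection in [F] from [u] to a vertex of [D] crosses [f]. *)
    apply: (connect_crosses uv); have := Df e eD; move: uf; rewrite /=.
    by case/orP: ev => /eqP -> /=; rewrite /bump /=; clear; lia.
  - by rewrite /h; move: ak; rewrite -/KE; lia.
  - by rewrite /h; move: l64; rewrite -/KE; lia.
  - by apply/subsetP => e; rewrite inE inKE -/KE /h /=; lia.
(* The right half is read backwards: under [rev_ord] the edges [h] to [a + l - 1] take the positions
   [k - (a + l)] to [k - h - 1]. *)
have [E [t [EA lE Eh]]] : exists D s, [/\ branch D A s, (l <= 8 * #|inK D|)%N &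
    forall e, e \in inK D -> ((rev_ord e).+1 < k - h)%N].
  apply: (@window_piece k (@rev_ord k) _ A KE l l_gt0 KEA _ _ (k - (a + l)) (k - h)).
  - exact: rev_ord_inj.
  - move=> D' s' DA' hD' e f g eD gD efg; apply: (inK_convex DA' hD' gD eD).
    by have := (ltn_ord e, ltn_ord f, ltn_ord g); move: efg; rewrite /=; clear; lia.
  - move=> D' s' F DA' hD' Fs u f uF uf Df.
    have [e [v [eD ev uv]]] := sibling_touches DA' hD' Fs uF.
    rewrite adj_connect_sym in uv.
    apply: (connect_crosses uv); have := Df e eD; move: uf; rewrite /=.
    have := (ltn_ord e, ltn_ord f, ltn_ord u).
    by case/orP: ev => /eqP -> /=; rewrite /bump /=; clear; lia.
  - exact: leq_subr.
  - by rewrite /h; move: l64 ak; rewrite -/KE; clear; lia.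
  - apply/subsetP => e; rewrite inE inKE -/KE /h /=; have := ltn_ord e; move: ak l64.
    by rewrite -/KE; clear; lia.
have sep e f : e \in inK D -> f \in inK E -> (e.+1 < f)%N.
  move=> /Dh eh /Eh /=; have := ltn_ord f; move: eh; rewrite /=; clear; lia.
have [e eD] : exists e, e \in inK D by apply/card_gt0P; move: lD l_gt0; clear; lia.
have [f fE] : exists e, e \in inK E by apply/card_gt0P; move: lE l_gt0; clear; lia.
(* [D] and [E] have their edges in [K] on different sides of [h], so neither contains the other and
   the branches part. *)
case: (branch_common DA EA) => [DE|ED|[B [C [r [s' [t' [NA [[DB EC]|[EB DC]]]]]]]]].
- by have := sep e e eD; rewrite (subsetP (setSI _ DE) _ eD) => /(_ isT); clear; lia.
- by have := sep f f; rewrite (subsetP (setSI _ ED) _ fE) fE => /(_ isT isT); clear; lia.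
- by apply: (separated_false NA DB EC lD lE) => e' f' e'D f'E; rewrite sep.
- by apply: (separated_false NA EB DC lE lD) => e' f' e'E f'D; rewrite (sep f' e') ?orbT.
Qed.

End Step.

Lemma tree_lower_bound A : lower_bound A.
Proof.
have [m] := ubnP (tree_size A); elim: m A => // m IHm A sA.
have IH B : (tree_size B < tree_size A)%N -> lower_bound B by move=> sB; apply: IHm; lia.
have [K KA lK] := maxlen_attained A.
have [e [s eA]] := branch_to_leaf A.
have l0 := maxlen_gt0 A.
(* Up to length 64, [log l / 6 <= 1], which is the excess of any leaf, passed up to [A]. *)
case: (leqP (maxlen (tree_edges A)) 64) => l64.
  have := bounded_branch n1 k2 eA (subxx _) (or_introl erefl) (@bounded_leaf R k n n1 k2 e).
  apply: bounded_le => //; have : (maxlen (tree_edges A) <= 2 ^ 6 * 1)%N by [].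
  move/(lg_le R l0); rewrite lg1 -/(ncomp _).
  have := ler0n R #|outer (components (tree_edges A)) (tree_edges (Leaf e)) set0|.
  lra.
apply: contrapT => lose; rewrite lK in l0 l64.
exact: (long_component_false IH KA lK l0 lose l64).
Qed.

End Main.

Theorem theorem8p3 (R : realType) (n k : nat) (hn : (1 <= n)%N)
  (hk : (2 <= k)%N) (A : pattern k) (AA : {set ptuple k n})
  (hAA : AA \in pathsets n (vertices (pattern_edges A))) :
  powRe (ntilde R n k)
        ((1 / 6)%:E * log2 ((maxlen (pattern_edges A))%:R : R)
         + (ncomp (pattern_edges A))%:R%:E)%E
    * density R (vertices (pattern_edges A)) AA
  <= (chi R A AA)%:R.
Proof.
case: A hAA => [A|] hAA /=.
  have /= := tree_lower_bound R hn hk hAA.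
  rewrite /log2 lne_EFin ?ltr0n ?maxlen_gt0 // -!EFinM -EFinD /=.
  by rewrite mul1r [6^-1 * _]mulrC.
(* For the empty pattern the length is 0, the exponent is [-oo] and the left side vanishes by
   convention. *)
have -> : maxlen (set0 : {set 'I_k}) = 0%N.
  apply: big1 => K /componentsP[v]; by rewrite vertices0 inE.
rewrite /log2 le0_lneNy // mulNyr gtr0_sg ?invr_gt0 ?ln2_gt0 // mul1e.
by rewrite mulrNy gtr0_sg ?divr_gt0 ?ltr0n // mul1e addNye mul0r.
Qed.
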